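(* Let $\rho\in(-1,1)$, $\rho\neq0$, $l>0$, $K>0$, and let $X_0=\Lambda_0$, $X_n=\rho X_{n-1}+\Lambda_n$ for $n\ge1$, where $\Lambda_0$ has law $\zeta$, $\Lambda_1,\Lambda_2,\ldots$ are i.i.d. and independent of $\Lambda_0$, and all $\Lambda_n$ ($n\ge0$) take values in $[-l,l]$. Let the observations $Y_n\in\{-1,1\}$, $n\ge1$, be conditionally independent given $(X_n)$ with $Y_n=1$ with probability $1/(1+e^{X_n})$ and $Y_n=-1$ otherwise, so that the potential functions are $$\Psi_n(\lambda_{0:n})=\Psi_n^X\left(\sum_{k=0}^n\rho^k\lambda_{n-k}\right),\qquad\Psi_n^X(x)=\frac{1}{1+e^{y_nx}} .$$ Set $\tau=|\rho|$, $l'=l/(1-\tau)$, $c=e^{l'}$, $\phi=e^{2l'}-1$, and assume $\tau c^3<1$. Then, for all $n\ge1$ and all $N$ large enough (threshold not depending on $n$), $$\mathcal{E}_{n,N}^{X}(y_{1:n})\leq C\left\{ \log(N)+D\right\} \left(\frac{1}{\sqrt{N}}\right)^{1+3\log c/\log\tau}+\frac{E_0}{\sqrt{N}},$$ where $$C=\frac{16}{\varepsilon^6c^2}\left(\frac{-1}{\log\tau}\right)\left(\frac{4c}{3\phi}\right)^{3\log c/\log\tau}\ \text{with } \varepsilon=1,\qquad D=2\log\left(\frac{3\phi}{4c\tau}\right),\qquad E_0=\frac{4Kl'c}{3\phi},$$ and $\mathcal{E}_{n,N}^{X}$ is the particle error for bounded Lipschitz functions of $X_n$ defined in the context.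
   Context: State space for $(\Lambda_n)$: $E=[-l,l]$; $v_{i:j}=(v_i,\ldots,v_j)$; $\langle\mu,f\rangle=\mu(f)=\int f\,d\mu$. $(\Lambda_n)$ is viewed as a Markov chain with initial law $\zeta$ and kernels $Q_n(\lambda,\cdot)=$ law of $\Lambda_n$ (mixing coefficient equal to $1$). The observations $y_{1:n}$ are fixed. For a measure $\mu$ on $E^n$ let $\gamma_n\mu(f)=\int\mu(d\lambda_{0:n-1})Q_n(\lambda_{n-1},d\lambda_n)\Psi_n(\lambda_{0:n})f(\lambda_{0:n})$, $R_n\mu(f)=\gamma_n\mu(f)/\gamma_n\mu(1)$, and $R_{1:n}\zeta=R_n\cdots R_1\zeta$ (the conditional law of $\Lambda_{0:n}$ given $Y_{1:n}=y_{1:n}$). Particle operators: for a probability measure $\mu'$, $S^N(\mu')=\frac1N\sum_{i=1}^N\delta_{Z_i}$ with $Z_1,\dots,Z_N$ i.i.d. of law $\mu'$. Let $\bar Q_n(\lambda_{0:n-1},d\lambda_{0:n}')=\delta_{\lambda_{0:n-1}}(d\lambda'_{0:n-1})Q_n(\lambda_{n-1},d\lambda_n')$ and $\Psi_n\cdot\nu(f)=\nu(\Psi_nf)/\nu(\Psi_n)$. For a probability measure $\mu$ on $E^n$, $R_n^N\mu=\Psi_n\cdot S^N(\bar Q_n\mu)$, and $R_{1:n}^N\zeta=R_n^N\cdots R_1^N\zeta$, with samples drawn afresh at each step, conditionally independently given the previous steps. Particle error for $X_n$: $\mathcal{E}_{n,N}^{X}(y_{1:n})=\sup_{g}\mathbb{E}_{N}\left(\left|\langle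 R_{1:n}\zeta-R_{1:n}^{N}\zeta,f_{g}\rangle\right|\right)$, the supremum being over functions $g:\mathbb R\to\mathbb R$ with $\Vert g\Vert_\infty=1$ that are Lipschitz with constant $K$, where $f_g(\lambda_{0:n})=g\left(\sum_{k=0}^n\rho^k\lambda_{n-k}\right)$, and $\mathbb E_N$ is the expectation over the particles only. *)

(* Defs.v *)
From HB Require Import structures.
From mathcomp Require Import all_boot all_order all_algebra.
From mathcomp Require Import all_classical all_reals all_analysis.
From mathcomp Require Import measurable_realfun ring lra.
Set Implicit Arguments.
Unset Strict Implicit.
Unset Printing Implicit Defensive.
Import Order.TTheory GRing.Theory Num.Theory.
Import numFieldNormedType.Exports.
Local Open Scope classical_set_scope.
Local Open Scope ring_scope.

(* A path of length n.+1 is lambda_{0:n}.  The state space [-l, l] is not a type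
   of its own: laws are probabilities on R, and the fact that they are carried
   by [-l, l] is part of the predicate hidden_markov_model below. *)
Notation Rm R := (measurableTypeR R).
Notation traj R n := ((n.+1).-tuple (Rm R)).

Section path_functions.
Context (R : realType).
Implicit Types (n : nat) (rho l x y v : R).

Definition path_last n (lam : traj R n) : Rm R := tnth lam ord_max.

Definition path_rcons n (lam : traj R n) (x : Rm R) : traj R n.+1 :=
  [tuple of rcons lam x].

(* sum_{k = 0}^n rho^k lambda_{n - k}, the value of X_n along lambda_{0:n} *)
Definition path_X rho n (lam : traj R n) : R :=
  \sum_(k < n.+1) rho ^+ k * tnth lam (rev_ord k).

(* Psi^X(x) = 1 / (1 + e^{y x}) *)
Definition psiX y x : R := (1 + expR (y * x))^-1.

Definition psi rho y n (lam : traj R n) : R := psiX y (path_X rho lam).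

(* probability that the observation equals v, given that the signal equals x *)
Definition obs_prob v x : R :=
  if v == 1 then (1 + expR x)^-1 else 1 - (1 + expR x)^-1.

Lemma obs_prob_psiX v x : v = -1 \/ v = 1 -> obs_prob v x = psiX v x.
Proof.
rewrite /obs_prob /psiX => -[->|->]; last by rewrite eqxx mul1r.
have x0 := expR_gt0 x.
rewrite ifF; last by apply/negbTE; rewrite lt_eqF//; lra.
rewrite mulN1r expRN; field.
by rewrite !gt_eqF//; lra.
Qed.

Lemma measurable_path_last n : measurable_fun [set: traj R n] (@path_last n).
Proof. exact: measurable_tnth. Qed.

Lemma measurable_path_rcons n :
  measurable_fun [set: traj R n * Rm R] (fun p => path_rcons p.1 p.2).
Proof.
apply/measurable_fun_tnthP => i /=.
have [ni|ni] := ltnP i n.+1.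
  rewrite (_ : _ \o _ =
      (fun lam : traj R n => tnth lam (Ordinal ni)) \o fst).
    by apply: measurableT_comp => //; exact: measurable_tnth.
  by apply/funext => p /=; rewrite !(tnth_nth 0)/= nth_rcons size_tuple ni.
rewrite (_ : _ \o _ = snd); first exact: measurable_snd.
apply/funext => p /=; rewrite (tnth_nth 0)/= nth_rcons size_tuple ltnNge ni/=.
by rewrite eqn_leq ni -ltnS ltn_ord.
Qed.

Lemma measurable_path_rconsr n (lam : traj R n) :
  measurable_fun [set: Rm R] (path_rcons lam).
Proof.
exact: (measurableT_comp (@measurable_path_rcons n) (measurable_pair1 lam)).
Qed.

Lemma measurable_psi rho y n :
  measurable_fun [set: traj R n] (@psi rho y n).
Proof.
apply: (measurableT_comp (f := psiX y)).
  have -> : psiX y = fun x => expR (- ln (1 + expR (y * x))).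
    apply/funext => x; rewrite expRN lnK ?inE// posrE.
    by rewrite addr_gt0 ?expR_gt0.
  apply: measurableT_comp => //; apply: measurableT_comp => //.
  apply: measurableT_comp; first exact: measurable_ln.
  apply: measurable_funD => //.
  by apply: measurableT_comp => //; exact: measurable_funM.
apply: measurable_sum => k; apply: measurable_funM => //.
exact: measurable_tnth.
Qed.

Lemma psi_ge0 rho y n (lam : traj R n) : 0 <= psi rho y lam.
Proof. by rewrite invr_ge0 addr_ge0 ?expR_ge0. Qed.

End path_functions.

Local Open Scope ereal_scope.

(* delta_{lambda_{0:n}}(d lambda'_{0:n}) Q(lambda_n, d lambda'_{n+1}) *)
Definition Qbar_fun (R : realType) (Q : R.-pker (Rm R) ~> (Rm R)) n
    (lam : traj R n) : set (traj R n.+1) -> \bar R :=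
  pushforward (Q (path_last lam)) (path_rcons lam).

Section Qbar.
Context (R : realType) (Q : R.-pker (Rm R) ~> (Rm R)) (n : nat).
Implicit Types lam : traj R n.

Let Qbar_pushforward lam : {measure set (traj R n.+1) -> \bar R} :=
  measure_function_pushforward__canonical__measure_function_Measure
    (Q (path_last lam)) (measurable_path_rconsr lam).

HB.instance Definition _ lam := isMeasure.Build _ _ _ (Qbar_fun Q lam)
  (measure0 (Qbar_pushforward lam)) (measure_ge0 (Qbar_pushforward lam))
  (@measure_semi_sigma_additive _ _ _ (Qbar_pushforward lam)).

Definition Qbar lam : {measure set (traj R n.+1) -> \bar R} := Qbar_fun Q lam.

Definition Q_last lam : {measure set (Rm R) -> \bar R} := Q (path_last lam).

Let measurable_Q_last U :
  measurable U -> measurable_fun [set: traj R n] (Q_last ^~ U).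
Proof.
move=> mU; apply: (measurableT_comp (measurable_kernel Q U mU)).
exact: measurable_path_last.
Qed.

HB.instance Definition _ := isKernel.Build _ _ _ _ _ Q_last measurable_Q_last.

Let Q_last1 lam : Q_last lam [set: Rm R] = 1. Proof. exact: prob_kernel. Qed.

HB.instance Definition _ :=
  Kernel_isProbability.Build _ _ _ _ _ Q_last Q_last1.

Let measurable_Qbar U : measurable U -> measurable_fun [set: traj R n] (Qbar ^~ U).
Proof.
move=> mU.
pose V := (fun p : traj R n * Rm R => path_rcons p.1 p.2) @^-1` U.
have mV : measurable V.
  by rewrite -[V]setTI; exact: measurable_path_rcons.
have := @measurable_fun_xsection_finite_kernel _ _ _ _ _ Q_last V.
rewrite inE => /(_ mV).
by apply: eq_measurable_fun => lam _; rewrite xsectionE.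
Qed.

HB.instance Definition _ := isKernel.Build _ _ _ _ _ Qbar measurable_Qbar.

Let Qbar1 lam : Qbar lam setT = 1.
Proof. exact: prob_kernel. Qed.

HB.instance Definition _ := Kernel_isProbability.Build _ _ _ _ _ Qbar Qbar1.

End Qbar.

(* (mu k)(A) = int mu(dx) k(x, A) *)
Section kernel_action.
Context d d' (X : measurableType d) (Y : measurableType d') (R : realType).
Variables (mu : probability X R) (k : R.-pker X ~> Y).

Definition kact (A : set Y) : \bar R := \int[mu]_x k x A.

Let kact0 : kact set0 = 0.
Proof. by apply: integral0_eq => x _; rewrite measure0. Qed.

Let kact_ge0 A : 0 <= kact A. Proof. exact: integral_ge0. Qed.

Let kact_sigma_additive : semi_sigma_additive kact.
Proof.
move=> F mF tF mUF; rewrite [X in _ --> X](_ : _ =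
    \int[mu]_x (\sum_(n <oo) k x (F n))); last first.
  apply: eq_integral => x _.
  by apply/esym/cvg_lim => //; exact: measure_semi_sigma_additive.
rewrite integral_nneseries//.
  by apply: is_cvg_ereal_nneg_natsum => n _; exact: integral_ge0.
by move=> n; exact: measurable_kernel.
Qed.

HB.instance Definition _ :=
  isMeasure.Build _ _ _ kact kact0 kact_ge0 kact_sigma_additive.

Let kactT : kact setT = 1.
Proof.
rewrite /kact; under eq_integral do rewrite prob_kernel.
by rewrite integral_cst ?mul1e//; exact: probability_setT.
Qed.

HB.instance Definition _ := Measure_isProbability.Build _ _ _ kact kactT.

End kernel_action.

(* nu_Psi(A) = int_A Psi d nu *)
Section density.
Context d (T : measurableType d) (R : realType).
Variables (nu : {measure set T -> \bar R}) (Psi : T -> R).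
Hypotheses (mPsi : measurable_fun setT Psi) (Psi0 : forall t, (0 <= Psi t)%R).

Definition with_density of measurable_fun setT Psi & (forall t, (0 <= Psi t)%R) :=
  fun A : set T => \int[nu]_(t in A) (Psi t)%:E.

Local Notation phi := (with_density mPsi Psi0).

Let phi0 : phi set0 = 0. Proof. exact: integral_set0. Qed.

Let phi_ge0 A : 0 <= phi A.
Proof. by apply: integral_ge0 => t _; rewrite lee_fin. Qed.

Let phi_sigma_additive : semi_sigma_additive phi.
Proof.
apply: semi_sigma_additive_nng_induced; first exact/measurable_EFinP.
by move=> t; rewrite lee_fin.
Qed.

HB.instance Definition _ :=
  isMeasure.Build _ _ _ phi phi0 phi_ge0 phi_sigma_additive.

End density.

Section empirical.
Context d (T : measurableType d) (R : realType) (N : nat).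
Variable z : 'I_N -> T.

Definition empirical (A : set T) : \bar R :=
  (N%:R^-1)%:E * \sum_(i < N) \d_(z i) A.

Let empirical0 : empirical set0 = 0.
Proof. by rewrite /empirical big1 ?mule0. Qed.

Let empirical_ge0 A : 0 <= empirical A.
Proof. by rewrite mule_ge0 ?lee_fin// sume_ge0. Qed.

Let empirical_sigma_additive : semi_sigma_additive empirical.
Proof.
pose m (k : nat) : {measure set T -> \bar R} :=
  if insub k is Some i then dirac (z i) else mzero.
have r0 : (0 <= N%:R^-1 :> R)%R by [].
have -> : empirical = mscale (NngNum r0) (msum m N).
  apply/funext => A; rewrite /empirical /mscale/=; congr *%E.
  by apply: eq_bigr => i _; rewrite /m valK.
exact: measure_semi_sigma_additive.
Qed.

HB.instance Definition _ :=
  isMeasure.Build _ _ _ empirical empirical0 empirical_ge0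
    empirical_sigma_additive.

End empirical.

(* gamma mu (1_A) = int mu(d lambda_{0:n}) Q(lambda_n, d lambda_{n+1})
                        Psi(lambda_{0:n+1}) 1_A(lambda_{0:n+1}) *)
Section gamma.
Context (R : realType) (n : nat).
Variables (Q : R.-pker (Rm R) ~> (Rm R)) (Psi : traj R n.+1 -> R).
Hypotheses (mPsi : measurable_fun setT Psi) (Psi0 : forall t, (0 <= Psi t)%R).
Variable mu : probability (traj R n) R.

Definition gamma of measurable_fun setT Psi & (forall t, (0 <= Psi t)%R) :=
  fun A : set (traj R n.+1) => \int[mu]_lam \int[Q (path_last lam)]_x
    (Psi (path_rcons lam x) * \1_A (path_rcons lam x))%:E.

Local Notation g := (gamma mPsi Psi0).

Let integrand_ge0 A (lam : traj R n) x :
  0 <= (Psi (path_rcons lam x) * \1_A (path_rcons lam x))%:E.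
Proof. by rewrite lee_fin mulr_ge0. Qed.

Let gamma0 : g set0 = 0.
Proof.
apply: integral0_eq => lam _; apply: integral0_eq => x _.
by rewrite indic0 mulr0.
Qed.

Let gamma_ge0 A : 0 <= g A.
Proof. by apply: integral_ge0 => lam _; exact: integral_ge0. Qed.

Let mintegrand A : measurable A -> measurable_fun [set: traj R n * Rm R]
  (fun p => (Psi (path_rcons p.1 p.2) * \1_A (path_rcons p.1 p.2))%:E).
Proof.
move=> mA; apply/measurable_EFinP.
apply: (measurableT_comp (f := fun t => (Psi t * \1_A t)%R)) => //.
  by apply: measurable_funM => //; exact: measurable_indic.
exact: measurable_path_rcons.
Qed.

Let gamma_sigma_additive : semi_sigma_additive g.
Proof.
move=> F mF tF mUF; rewrite [X in _ --> X](_ : _ =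
    \int[mu]_lam \sum_(i <oo) \int[Q (path_last lam)]_x
      (Psi (path_rcons lam x) * \1_(F i) (path_rcons lam x))%:E).
  rewrite integral_nneseries//.
  - by apply: is_cvg_ereal_nneg_natsum => i _; exact: gamma_ge0.
  - move=> i; have := @measurable_fun_integral_finite_kernel _ _ _ _ _
      (fun p => (Psi (path_rcons p.1 p.2) * \1_(F i) (path_rcons p.1 p.2))%:E)
      (Q_last Q (n := n)); apply; last exact: mintegrand.
    by move=> p; exact: integrand_ge0.
  - by move=> i lam _; exact: integral_ge0.
apply: eq_integral => lam _; rewrite -integral_nneseries//; last first.
  move=> i; exact: (measurableT_comp (mintegrand (mF i)) (measurable_pair1 lam)).
apply: eq_integral => x _.
under eq_eseriesr do rewrite EFinM.
by rewrite nneseriesZl// EFinM indic_bigcup.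
Qed.

HB.instance Definition _ :=
  isMeasure.Build _ _ _ g gamma0 gamma_ge0 gamma_sigma_additive.

End gamma.

Section filters.
Context (R : realType).

(* All total masses met below are positive and finite, so the default
   probability required by mnormalize is never used. *)
Definition normalize n (nu : {measure set (traj R n) -> \bar R}) :
    probability (traj R n) R :=
  mnormalize nu (dirac [tuple of nseq n.+1 (0%R : Rm R)]).

(* Psi . nu *)
Definition reweight rho y n (nu : {measure set (traj R n) -> \bar R}) :
    probability (traj R n) R :=
  normalize (with_density nu (@measurable_psi R rho y n) (@psi_ge0 R rho y n)).

(* The law zeta of lambda_0, seen as a law on paths of length 1. *)
Definition path0 (x : Rm R) : traj R 0 := [tuple x].

Lemma measurable_path0 : measurable_fun [set: Rm R] path0.
Proof.
apply/measurable_fun_tnthP => i; rewrite (_ : _ \o _ = id)//.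
by apply/funext => x /=; rewrite (ord1 i).
Qed.

HB.instance Definition _ := isMeasurableFun.Build _ _ _ _ path0 measurable_path0.

Definition init_law (zeta : probability (Rm R) R) : probability (traj R 0) R :=
  distribution zeta path0.

Variables (rho : R) (y : nat -> R).
Variables (zeta : probability (Rm R) R) (Q : nat -> R.-pker (Rm R) ~> (Rm R)).

(* R_{n+1} mu = gamma_{n+1} mu / gamma_{n+1} mu (1) *)
Definition Rstep n (mu : probability (traj R n) R) :
    probability (traj R n.+1) R :=
  normalize (gamma (Q n.+1) mu (@measurable_psi R rho (y n.+1) n.+1)
    (@psi_ge0 R rho (y n.+1) n.+1)).

(* R_{1:n} zeta *)
Fixpoint Rfilter n : probability (traj R n) R :=
  if n is m.+1 then Rstep (Rfilter m) else init_law zeta.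

Section particles.
Context d (T : measurableType d) (P : probability T R) (N : nat).

(* Z n i is the i-th particle drawn at step n >= 1 (Z 0 is not used). *)
Variable Z : forall n, 'I_N -> {RV P >-> traj R n}.

(* R^N_{1:n} zeta = Psi_n . S^N(Qbar_n R^N_{1:n-1} zeta), the law of the sample
   defining S^N being prescribed by particle_system *)
Definition Pfilter n (w : T) : probability (traj R n) R :=
  match n with
  | 0%N => init_law zeta
  | m.+1 => reweight rho (y m.+1) (empirical R (fun i => Z m.+1 i w))
  end.

(* sigma(Z_k^i : 1 <= k <= n, i < N) *)
Definition particle_past n : set (set T) :=
  <<s [set B | exists k (i : 'I_N) (A : set (traj R k)),
         [/\ (1 <= k <= n)%N, measurable A & B = Z k i @^-1` A] ] >>.

(* Given the steps 1, ..., n, the particles Z_{n+1}^1, ..., Z_{n+1}^N are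
   i.i.d. with law Qbar_{n+1} R^N_{1:n} zeta. *)
Definition particle_system : Prop :=
  forall n (B : set T), particle_past n B ->
  forall A : 'I_N -> set (traj R n.+1), (forall i, measurable (A i)) ->
    P (B `&` \bigcap_i (Z n.+1 i @^-1` A i)) =
    \int[P]_(w in B)
      (\prod_(i < N) fine (kact (Pfilter n w) (Qbar (Q n.+1) (n := n)) (A i)))%:E.

(* <R_{1:n} zeta - R^N_{1:n} zeta, f> *)
Definition filter_diff n (f : traj R n -> R) (w : T) : R :=
  (\int[Rfilter n]_lam f lam - \int[Pfilter n w]_lam f lam)%R.

Definition particle_error (K : R) n : \bar R :=
  ereal_sup [set \int[P]_w `|filter_diff (fun lam : traj R n => g (path_X rho lam)) w|%:E
    | g in [set g : R -> R |
        ereal_sup (range (fun x => `|g x|%:E)) = 1 /\ K.-lipschitz g]].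

End particles.
End filters.

(* The constant kernel lambda |-> q. *)
Definition const_kernel (R : realType) (q : probability (Rm R) R) :
    R.-pker (Rm R) ~> (Rm R) :=
  kprobability (measurable_cst (q : pprobability (Rm R) R)).

Section model.
Context (R : realType) (rho l : R).
Context d (T : measurableType d) (P : probability T R).
Variables (Lambda Y : nat -> {RV P >-> R}).
Variables (zeta q : probability (Rm R) R).

(* X_0 = Lambda_0, X_n = rho X_{n-1} + Lambda_n *)
Fixpoint signal n (w : T) : R :=
  if n is m.+1 then (rho * signal m w + Lambda m.+1 w)%R else Lambda 0%N w.

Definition signal_events : set (set T) :=
  <<s [set B | exists k (A : set R), measurable A /\ B = signal k @^-1` A ] >>.

Record hidden_markov_model : Prop := HiddenMarkovModel {
  hmm_support : forall n w, (- l <= Lambda n w <= l)%R ;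
  hmm_law0 : forall A, measurable A -> P (Lambda 0%N @^-1` A) = zeta A ;
  hmm_law : forall n A, (1 <= n)%N -> measurable A ->
    P (Lambda n @^-1` A) = q A ;
  hmm_indep : forall n (A : nat -> set R), (forall k, measurable (A k)) ->
    P (\bigcap_(k in [set k | (k <= n)%N]) Lambda k @^-1` A k) =
    (\prod_(k < n.+1) fine (P (Lambda k @^-1` A k)))%:E ;
  hmm_obs : forall n w, (1 <= n)%N -> Y n w = (-1)%R \/ Y n w = 1%R ;
  (* given the signal, Y_1, ..., Y_n are independent and Y_k = v has
     probability obs_prob v X_k *)
  hmm_obs_law : forall n (B : set T) (v : nat -> R), signal_events B ->
    (forall k, v k = (-1)%R \/ v k = 1%R) ->
    P (B `&` \bigcap_(k in [set k | (1 <= k <= n)%N]) Y k @^-1` [set v k]) =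
    \int[P]_(w in B) (\prod_(1 <= k < n.+1) obs_prob (v k) (signal k w))%:E }.

End model.

(* Main.v *)
Require Import Defs.
From HB Require Import structures.
From mathcomp Require Import all_boot all_order all_algebra.
From mathcomp Require Import all_classical all_reals all_analysis.
From mathcomp Require Import measurable_realfun ring lra.
Set Implicit Arguments.
Unset Strict Implicit.
Unset Printing Implicit Defensive.
Import Order.TTheory GRing.Theory Num.Theory.
Import numFieldNormedType.Exports.
Local Open Scope classical_set_scope.
Local Open Scope ring_scope.

(** The signal forgets its past at rate [tau = |rho|] and [x |-> ln (psiX y x)]
    is 1-Lipschitz, so every backward potential [w = psiX * G] (the conditional
    likelihood of the remaining observations) is log-Lipschitz with constant
    [L = 1 / (1 - tau)], uniformly in the time horizon. Two copies of the
    conditioned signal started at distance [r] can thus be driven by the same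
    noise with probability at least [exp (- 2 L tau r)], after which their
    distance is at most [tau r]; in the modulus [1 - exp (- B r)], with [B]
    large, the conditional mean of [g X_n] given [X_k] and the later
    observations therefore contracts by a fixed factor [kappa < 1] at each
    backward step, with no mixing assumption on the noise. Telescoping
    [R_{1:n} - R^N_{1:n}] over the sampling steps, the error made at step [k]
    is a Monte Carlo error of order [kappa ^ (n - k) / sqrt N], so the total
    error is at most [C' / sqrt N] uniformly in [n]. Since [ln N] tends to
    infinity and [1 + 3 ln c / ln tau <= 1], this is eventually below the
    claimed bound. *)

(** * Expectations of bounded measurable functions *)

Section bounded_measurable.
Context d (X : measurableType d) (R : realType).
Implicit Types (f g : X -> R) (m : probability X R).

(** Such functions are integrable for every probability, so [Rintegral] is linear and monotone on
    them without side conditions. *)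
Definition bmeas f := measurable_fun setT f /\ exists M, forall x, `|f x| <= M.

Lemma bmeas_cst (a : R) : bmeas (fun=> a).
Proof. by split; [exact: measurable_cst|exists `|a|]. Qed.

Lemma bmeasD f g : bmeas f -> bmeas g -> bmeas (fun x => f x + g x).
Proof.
move=> [mf [M fM]] [mg [M' gM']]; split; first exact: measurable_funD.
by exists (M + M') => x; rewrite (le_trans (ler_normD _ _))// lerD.
Qed.

Lemma bmeasM f g : bmeas f -> bmeas g -> bmeas (fun x => f x * g x).
Proof.
move=> [mf [M fM]] [mg [M' gM']]; split; first exact: measurable_funM.
by exists (M * M') => x; rewrite normrM ler_pM.
Qed.

Lemma bmeasZ (a : R) f : bmeas f -> bmeas (fun x => a * f x).
Proof. by move=> bf; apply: bmeasM => //; exact: bmeas_cst. Qed.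

Lemma bmeasB f g : bmeas f -> bmeas g -> bmeas (fun x => f x - g x).
Proof.
move=> bf bg; under eq_fun do rewrite -mulN1r.
by apply: bmeasD => //; exact: bmeasZ.
Qed.

Lemma bmeas_sum (I : Type) (s : seq I) (F : I -> X -> R) :
  (forall i, bmeas (F i)) -> bmeas (fun x => \sum_(i <- s) F i x).
Proof.
move=> bF; elim: s => [|i s IH].
  by under eq_fun do rewrite big_nil; exact: bmeas_cst.
by under eq_fun do rewrite big_cons; exact: bmeasD.
Qed.

Lemma bmeas_indic (A : set X) : measurable A -> bmeas (\1_A : X -> R).
Proof.
move=> mA; split; first exact: measurable_indic.
by exists 1 => x; rewrite indicE; case: (_ \in _); rewrite /= ?normr1 ?normr0.
Qed.

Lemma bmeas_norm f : bmeas f -> bmeas (fun x => `|f x|).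
Proof.
move=> [mf [M fM]]; split; first exact: measurableT_comp.
by exists M => x; rewrite normr_id.
Qed.

Lemma bmeas_itv f (a b : R) : measurable_fun setT f ->
  (forall x, a <= f x <= b) -> bmeas f.
Proof.
move=> mf fab; split=> //; exists (`|a| + `|b|) => x.
have /andP[afx fxb] := fab x.
have := ler_norm b; have := ler_norm (- a); rewrite normrN.
have := normr_ge0 a; have := normr_ge0 b.
by rewrite ler_norml; move=> *; apply/andP; split; lra.
Qed.

Lemma bmeas_gt0 f : bmeas f -> exists2 M, 0 < M & forall x, `|f x| <= M.
Proof.
move=> [_ [M fM]]; exists (`|M| + 1); first by rewrite ltr_wpDl.
by move=> x; rewrite (le_trans (fM x))// (le_trans (ler_norm M))// lerDl.
Qed.

Lemma bmeas_integrable m f : bmeas f -> m.-integrable setT (EFin \o f).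
Proof.
move=> [mf [M fM]]; apply: measurable_bounded_integrable => //.
  by apply: (le_lt_trans (probability_le1 m measurableT)); rewrite ltry.
exists M; split; first exact: num_real.
by move=> x Mx t _ /=; rewrite (le_trans (fM t))// ltW.
Qed.

(** Abstracted from integrals so that the same rules serve integrals, tilted means, empirical means
    and integrals after a kernel step. *)
Record positive_linear (L : (X -> R) -> R) : Prop := PositiveLinear {
  pl_add : forall f g, bmeas f -> bmeas g -> L (fun x => f x + g x) = L f + L g ;
  pl_scale : forall a f, bmeas f -> L (fun x => a * f x) = a * L f ;
  pl_le : forall f g, bmeas f -> bmeas g -> (forall x, f x <= g x) -> L f <= L g }.

Lemma positive_linear_Rintegral m : positive_linear (Rintegral m setT).
Proof.
split=> [f g bf bg|a f bf|f g bf bg fg].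
- by rewrite RintegralD//; exact: bmeas_integrable.
- by rewrite RintegralZl//; exact: bmeas_integrable.
- by apply: le_Rintegral => //; exact: bmeas_integrable.
Qed.

Section positive_linear_theory.
Variables (L : (X -> R) -> R) (plL : positive_linear L).

Lemma pl0 : L (fun=> 0) = 0.
Proof.
have := pl_scale plL 0 (bmeas_cst 0).
by under eq_fun do rewrite mul0r; rewrite mul0r.
Qed.

Lemma plB f g : bmeas f -> bmeas g -> L (fun x => f x - g x) = L f - L g.
Proof.
move=> bf bg; under eq_fun do rewrite -mulN1r.
by rewrite (pl_add plL) ?(pl_scale plL) ?mulN1r//; exact: bmeasZ.
Qed.

Lemma pl_sum (I : Type) (s : seq I) (F : I -> X -> R) :
  (forall i, bmeas (F i)) ->
  L (fun x => \sum_(i <- s) F i x) = \sum_(i <- s) L (F i).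
Proof.
move=> bF; elim: s => [|i s IH].
  by rewrite big_nil; under eq_fun do rewrite big_nil; exact: pl0.
rewrite big_cons; under eq_fun do rewrite big_cons.
by rewrite (pl_add plL) ?IH//; exact: bmeas_sum.
Qed.

Lemma pl_cst a : L (fun=> a) = a * L (fun=> 1).
Proof.
rewrite -(pl_scale plL); last exact: bmeas_cst.
by under [in RHS]eq_fun do rewrite mulr1.
Qed.

Lemma pl_ge0 f : bmeas f -> (forall x, 0 <= f x) -> 0 <= L f.
Proof.
by move=> bf f0; rewrite -[leLHS]pl0 (pl_le plL)//; exact: bmeas_cst.
Qed.

End positive_linear_theory.

End bounded_measurable.

(** * Layer-cake approximation *)

Section layer_cake.
Context (R : realType).

(* The largest multiple of [1 / J] at most [v], written as a sum of superlevel
   indicators: this reduces bounded functions to sets. *)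
Definition layers (J : nat) (v : R) : R :=
  J%:R^-1 * \sum_(j < J) (j.+1%:R / J%:R <= v)%R%:R.

(** The sum counts the [j < J] with [j + 1 <= v J]; there are [truncn (v J)] of them, since [v <= 1]
    keeps this number at most [J]. *)
Lemma layers_itv (J : nat) (v : R) : (0 < J)%N -> 0 <= v <= 1 ->
  layers J v <= v <= layers J v + J%:R^-1.
Proof.
move=> J0 /andP[v0 v1]; have JR0 : 0 < J%:R :> R by rewrite ltr0n.
have vJ0 : 0 <= v * J%:R by rewrite mulr_ge0.
set k := Num.truncn (v * J%:R).
have kJ : (k <= J)%N.
  rewrite -(ler_nat R); have /andP[+ _] := truncn_itv vJ0.
  by move=> /le_trans; apply; rewrite -[leRHS]mul1r ler_wpM2r// ltW.
have -> : layers J v = k%:R / J%:R.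
  rewrite /layers mulrC; congr (_ / _).
  under eq_bigr => j _ do rewrite ler_pdivrMr// -truncn_ge_nat// -/k.
  rewrite -natr_sum; congr (_%:R).
  rewrite -(big_mkord xpredT (fun j => nat_of_bool (j < k)%N)).
  rewrite (big_cat_nat (leq0n k) kJ)/= [X in (_ + X)%N]big_nat_cond.
  rewrite [X in (_ + X)%N]big1 ?addn0; last first.
    by move=> j /andP[/andP[kj _] _]; rewrite ltnNge kj.
  rewrite big_nat_cond (eq_bigr (fun=> 1%N)); last first.
    by move=> j /andP[/andP[_ ->]].
  by rewrite -big_nat_cond sum_nat_const_nat subn0 muln1.
have /andP[h1 h2] := truncn_itv vJ0; rewrite -/k in h1 h2.
rewrite ler_pdivrMr// h1/=.
by rewrite -[X in _ + X]mul1r -mulrDl ler_pdivlMr// -natr1 in h2 *; exact: ltW.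
Qed.

(** Archimedean passage to the limit: it removes the error [c / J] left by a mesh of size
    [1 / J]. *)
Lemma le0_of_le_invn (a c : R) : (forall J, (0 < J)%N -> a <= c / J%:R) -> a <= 0.
Proof.
move=> aJ; rewrite leNgt; apply/negP => a0.
have c0 : 0 < c.
  by have := aJ 1%N isT; rewrite divr1; exact: lt_le_trans.
pose J := (Num.truncn (c / a)).+1.
have := aJ J isT; rewrite ler_pdivlMr ?ltr0n// leNgt => /negP; apply.
rewrite mulrC -ltr_pdivrMr//.
by have /andP[] := truncn_itv (ltW (divr_gt0 c0 a0)).
Qed.

End layer_cake.

(** * Functionals determined by their values on sets *)

Section positive_linear_uniqueness.
Context d (X : measurableType d) (R : realType).
Variables L L' : (X -> R) -> R.
Hypotheses (plL : positive_linear L) (plL' : positive_linear L').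
Hypothesis LL' : forall A, measurable A -> L \1_A = L' \1_A.

Let step J (f : X -> R) x : R := layers J (f x).

Lemma superlevel_indic (f : X -> R) a :
  (fun x => (a <= f x)%R%:R) = \1_[set x | a <= f x] :> (X -> R).
Proof. by apply/funext => x; rewrite indicE; congr (_%:R); rewrite mem_setE. Qed.

Lemma measurable_superlevel (f : X -> R) a :
  measurable_fun setT f -> measurable [set x | a <= f x].
Proof.
move=> mf; rewrite -[X in measurable X]setTI.
have -> : [set x | a <= f x] = f @^-1` `[a, +oo[%classic.
  by apply/seteqP; split => x /=; rewrite in_itv/= andbT.
exact: mf.
Qed.

Lemma bmeas_superlevel (f : X -> R) a :
  measurable_fun setT f -> bmeas (fun x => (a <= f x)%R%:R : R).
Proof.
by move=> mf; rewrite superlevel_indic; apply: bmeas_indic; exact: measurable_superlevel.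
Qed.

Let bmeas_step J (f : X -> R) : measurable_fun setT f -> bmeas (step J f).
Proof.
by move=> mf; apply: bmeasZ; apply: bmeas_sum => j; exact: bmeas_superlevel.
Qed.

Let one_indic : (fun=> 1) = \1_setT :> (X -> R).
Proof. by apply/funext => x; rewrite indicT. Qed.

Let eq_step J (f : X -> R) : measurable_fun setT f -> L (step J f) = L' (step J f).
Proof.
move=> mf; rewrite /step /layers (pl_scale plL) ?(pl_scale plL');
  try by apply: bmeas_sum => j; exact: bmeas_superlevel.
rewrite (pl_sum plL) ?(pl_sum plL'); try by move=> j; exact: bmeas_superlevel.
congr (_ * _); apply: eq_bigr => j _.
by rewrite superlevel_indic; apply: LL'; exact: measurable_superlevel.
Qed.

(** [step J f] lies below [f] within [1 / J] uniformly, and both functionals agree on it because it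
    is a combination of indicators. *)
Let eq01 (f : X -> R) : measurable_fun setT f -> (forall x, 0 <= f x <= 1) -> L f = L' f.
Proof.
move=> mf f01; have bf := bmeas_itv mf f01.
(* Stated for an arbitrary ordered pair: it is applied to [(L, L')] and to [(L', L)]. *)
have key M M' : positive_linear M -> positive_linear M' ->
    M (fun=> 1) = M' (fun=> 1) ->
    (forall J, M (step J f) = M' (step J f)) -> M f - M' f <= 0.
  move=> pM pM' M1 MM'; apply: (@le0_of_le_invn _ _ (M' (fun=> 1))) => J J0.
  have bs := bmeas_step J mf; have bc := bmeas_cst X (J%:R^-1 : R).
  have : M f <= M (fun x => step J f x + J%:R^-1).
    apply: (pl_le pM) => //; first exact: bmeasD.
    by move=> x; have /andP[] := layers_itv J0 (f01 x).
  have : M' (step J f) <= M' f.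
    apply: (pl_le pM') => //.
    by move=> x; have /andP[] := layers_itv J0 (f01 x).
  rewrite (pl_add pM)// (pl_cst pM) M1 MM' [_^-1 * _]mulrC.
  by move=> *; lra.
have L1 : L (fun=> 1) = L' (fun=> 1) by rewrite one_indic; exact: LL'.
apply/eqP; rewrite eq_le -subr_le0 -[X in _ && X]subr_le0.
by apply/andP; split; apply: key => // J; rewrite eq_step.
Qed.

(** An affine change of variable brings the range of [f] into [[0, 1]]; both functionals respect it
    because they agree on constants. *)
Lemma positive_linear_unique f : bmeas f -> L f = L' f.
Proof.
move=> bf; have [M M0 fM] := bmeas_gt0 bf.
pose g x := (f x + M) / (2 * M).
have M20 : 0 < 2 * M by rewrite mulr_gt0.
have mg : measurable_fun setT g.
  by apply: measurable_funM => //; apply: measurable_funD => //; case: bf.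
have g01 x : 0 <= g x <= 1.
  have := fM x; rewrite ler_norml => /andP[h1 h2].
  by rewrite ler_pdivlMr// ler_pdivrMr//; apply/andP; split; lra.
have bg := bmeas_itv mg g01.
have bg2 := bmeasZ (2 * M) bg.
have -> : f = fun x => 2 * M * g x - M.
  by apply/funext => x; rewrite /g; field; rewrite gt_eqF.
have bM := bmeas_cst X M.
rewrite (plB plL)// (plB plL')// (pl_scale plL)// (pl_scale plL')//.
rewrite (pl_cst plL) (pl_cst plL') (eq01 mg)//.
by rewrite one_indic LL'.
Qed.

End positive_linear_uniqueness.

Section expectation.
Context d (X : measurableType d) (R : realType) (m : probability X R).
Implicit Types f g : X -> R.

Lemma Rintegral_indic (A : set X) : measurable A ->
  \int[m]_x \1_A x = fine (m A).
Proof.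
by move=> mA; rewrite /Rintegral integral_indic// setIT.
Qed.

Lemma Rintegral_probability_cst (a : R) : \int[m]_x a = a.
Proof.
rewrite Rintegral_cst// [fine _](_ : _ = 1) ?mulr1//.
by rewrite -[RHS]/(fine 1%E); congr fine; exact: probability_setT.
Qed.

Lemma EFin_Rintegral f : bmeas f ->
  (\int[m]_x f x)%:E = (\int[m]_x (f x)%:E)%E.
Proof.
move=> /(bmeas_integrable m) fi; rewrite fineK//.
exact: integrable_fin_num.
Qed.

(** Turns a formula for the measure of sets into one for integrals; this is how the normalised
    filters are made explicit below. *)
Lemma RintegralE (L : (X -> R) -> R) : positive_linear L ->
  (forall A, measurable A -> fine (m A) = L \1_A) ->
  forall f, bmeas f -> \int[m]_x f x = L f.
Proof.
move=> plL mL f bf.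
apply: (positive_linear_unique (positive_linear_Rintegral m) plL) => //.
by move=> A mA; rewrite Rintegral_indic ?mL.
Qed.

(** A zero integral would make [f] vanish almost everywhere, so the whole space would be null
    although it has mass 1. This makes the normalising constants positive. *)
Lemma Rintegral_gt0 f : bmeas f -> (forall x, 0 < f x) -> 0 < \int[m]_x f x.
Proof.
move=> bf f0; rewrite lt_neqAle Rintegral_ge0 ?andbT; last first.
  by move=> x _; exact: ltW.
apply/eqP => /esym mf0.
have : (\int[m]_x `|(f x)%:E| = 0)%E.
  under eq_integral => x _ do rewrite gee0_abs ?lee_fin ?ltW//.
  by rewrite -EFin_Rintegral// mf0.
case: bf => mf _.
move/(ae_eq_integral_abs m measurableT _).1; case; first exact/measurable_EFinP.
move=> A [mA mA0 hA].
have : m setT = 0%E.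
  apply: (subset_measure0 _ mA _ mA0) => //.
  apply: subset_trans hA => x _ /= /(_ Logic.I) [].
  by apply/eqP; rewrite gt_eqF.
by rewrite probability_setT => /eqP; rewrite onee_eq0.
Qed.

End expectation.

Lemma bmeas_comp d d' (X : measurableType d) (Y : measurableType d')
    (R : realType) (f : Y -> R) (phi : X -> Y) :
  measurable_fun setT phi -> bmeas f -> bmeas (fun x => f (phi x)).
Proof.
move=> mphi [mf [M fM]]; split; first exact: measurableT_comp.
by exists M => x.
Qed.

Lemma bmeas_Rintegral d d' (X : measurableType d) (Y : measurableType d')
    (R : realType) (m : probability Y R) (f : X * Y -> R) :
  bmeas f -> bmeas (fun x => \int[m]_y f (x, y)).
Proof.
move=> bf; have [M M0 fM] := bmeas_gt0 bf.
have bfx x : bmeas (fun y => f (x, y)).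
  exact: (bmeas_comp (measurable_pair1 x)).
have pl := positive_linear_Rintegral m.
have bM : bmeas (fun _ : Y => M) by exact: bmeas_cst.
split; last first.
  exists M => x; rewrite (le_trans (le_normr_Rintegral _ (bmeas_integrable m (bfx x))))//.
  rewrite -[leRHS](Rintegral_probability_cst m).
  by apply: (pl_le pl) => //; exact: bmeas_norm.
(* Adding the bound [M] makes the integrand nonnegative, so that Tonelli's theorem gives
   measurability in [x]. *)
have -> : (fun x => \int[m]_y f (x, y)) =
    (fun x => (fine (\int[m]_y (f (x, y) + M)%:E)%E) - M).
  apply/funext => x; rewrite -/(Rintegral _ _ _) (pl_add pl)//.
  by rewrite Rintegral_probability_cst addrK.
apply: measurable_funB => //.
apply: (measurableT_comp (f := fine)); first exact: fine_measurable.
apply: (@measurable_fun_fubini_tonelli_F _ _ _ _ _ m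
  (fun p => (f p + M)%:E)); last first.
  by move=> p; rewrite lee_fin; have := fM p; rewrite ler_norml => /andP[]; lra.
apply/measurable_EFinP; apply: measurable_funD => //; by case: bf.
Qed.

(** * Stability of the conditioned signal *)

Ltac bmeas_tac := repeat first
  [ assumption | exact: bmeas_cst | exact: positive_linear_Rintegral
  | apply: bmeasB | apply: bmeasD | apply: bmeasM | apply: bmeas_norm ].

Section tilted_means.
Context d (X : measurableType d) (R : realType) (m : probability X R).
Variables (W W' p p' : X -> R) (theta D delta : R).
Hypotheses (bW : bmeas W) (bW' : bmeas W') (bp : bmeas p) (bp' : bmeas p').
Hypotheses (W0 : forall x, 0 < W x) (W'0 : forall x, 0 < W' x).
Hypotheses (theta01 : 0 <= theta <= 1).
Hypothesis WW' : forall x,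
  theta * (W x / \int[m]_t W t) <= W' x / \int[m]_t W' t.
Hypothesis pD : forall x t, p x <= p' t + D.
Hypothesis pdelta : forall x, p x <= p' x + delta.

(* The second tilted law dominates [theta] times the first one: a coupling that
   succeeds with probability [theta], costing [delta] then and [D] otherwise. *)
Lemma tilted_mean_diff :
  (\int[m]_x (W x * p x)) / (\int[m]_x W x) -
  (\int[m]_x (W' x * p' x)) / (\int[m]_x W' x) <= (1 - theta) * D + theta * delta.
Proof.
have pl := positive_linear_Rintegral m.
have A0 := Rintegral_gt0 m bW W0; have A'0 := Rintegral_gt0 m bW' W'0.
set A := \int[m]_x W x in A0 *; set A' := \int[m]_x W' x in A'0 *.
set b := (\int[m]_x (W x * p x)) / A.
have bA : \int[m]_x (W x * p x) = b * A by rewrite /b divfK// gt_eqF.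
have bp'D t : b <= p' t + D.
  rewrite -(ler_pM2r A0) -bA -(pl_scale pl)//; apply: (pl_le pl); try bmeas_tac.
  by move=> x; rewrite mulrC ler_wpM2r// ltW.
have Wp' : (b - delta) * A <= \int[m]_x (W x * p' x).
  have -> : (b - delta) * A = \int[m]_x (W x * p x - delta * W x).
    by rewrite (plB pl) ?(pl_scale pl)//; try bmeas_tac; rewrite bA mulrBl.
  apply: (pl_le pl); try bmeas_tac.
  by move=> x; rewrite [delta * _]mulrC -mulrBr ler_wpM2l ?(ltW (W0 _))// lerBlDr.
(* The excess of the second density over [theta] times the first, multiplied by the slack
   [p' + D - b]: both are nonnegative, and expanding the integral yields the claim. *)
have : 0 <= \int[m]_x ((W' x / A' - theta * (W x / A)) * (p' x + (D - b))).
  apply: Rintegral_ge0 => x _; apply: mulr_ge0; first by rewrite subr_ge0 WW'.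
  by rewrite addrA subr_ge0.
have -> : (fun x => (W' x / A' - theta * (W x / A)) * (p' x + (D - b))) =
    (fun x => A'^-1 * (W' x * p' x) + (- (theta / A)) * (W x * p' x) +
      (D - b) / A' * W' x + (- ((D - b) * theta / A)) * W x).
  by apply/funext => x; ring.
rewrite ?(pl_add pl) ?(pl_scale pl); try bmeas_tac.
rewrite -/A -/A'.
have -> : (D - b) / A' * A' = D - b by rewrite divfK// gt_eqF.
have -> : - ((D - b) * theta / A) * A = - ((D - b) * theta).
  by rewrite mulNr divfK// gt_eqF.
have /andP[t0 t1] := theta01.
have : theta * (b - delta) <= theta / A * \int[m]_x (W x * p' x).
  by rewrite -mulrA ler_wpM2l// mulrC ler_pdivlMr.
rewrite [A'^-1 * _]mulrC mulNr.
move: (_ / A') (theta / A * _) => u v. move=> *; nra.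
Qed.

End tilted_means.

(** * The exponential modulus and log-Lipschitz potentials *)

Section exponential_modulus.
Context (R : realType).
Implicit Types s S beta : R.

(** By [1 + x <= exp x], the gain [exp (- beta s) - exp (- s)] is at least [exp (- s) (1 - beta) s];
    then [s >= 1 - exp (- s)] and [s <= S] make it a fixed fraction of [1 - exp (- s)]. For
    [beta < 1], a contraction of distances thus contracts the modulus by a fixed factor. *)
Lemma expN_contract s S beta : 0 <= s <= S -> 0 <= beta <= 1 ->
  1 - expR (- (beta * s)) <= (1 - expR (- S) * (1 - beta)) * (1 - expR (- s)).
Proof.
move=> /andP[s0 sS] /andP[b0 b1].
have e1 : expR (- (beta * s)) = expR (- s) * expR ((1 - beta) * s).
  by rewrite -expRD; congr expR; ring.
have e2 : 1 + (1 - beta) * s <= expR ((1 - beta) * s).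
  by apply: expR_ge1Dx.
have e3 : expR (- S) <= expR (- s) by rewrite ler_expR lerN2.
have e4 : 1 - expR (- s) <= s by have := expR_ge1Dx (- s); lra.
have e5 : 0 < expR (- S) by exact: expR_gt0.
have e6 : 0 < expR (- s) by exact: expR_gt0.
have e7 : expR (- s) * (1 + (1 - beta) * s) <= expR (- (beta * s)).
  by rewrite e1 ler_wpM2l// ltW.
have e8 : expR (- S) * ((1 - beta) * (1 - expR (- s))) <=
          expR (- s) * ((1 - beta) * s).
  apply: ler_pM => //.
  - apply: mulr_ge0; first by rewrite subr_ge0.
    by rewrite subr_ge0 -expR0 ler_expR oppr_le0.
  - by rewrite ler_wpM2l// subr_ge0.
by rewrite mulrBl mul1r -mulrA; lra.
Qed.

Lemma psiX_gt0 (y v : R) : 0 < psiX y v.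
Proof. by rewrite invr_gt0 addr_gt0 ?expR_gt0. Qed.

Lemma psiX_le1 (y v : R) : psiX y v <= 1.
Proof. by rewrite invf_le1 ?lerDl ?expR_ge0// addr_gt0 ?expR_gt0. Qed.

Lemma measurable_psiX (y : R) : measurable_fun setT (psiX y).
Proof.
have -> : psiX y = fun x => expR (- ln (1 + expR (y * x))).
  apply/funext => x; rewrite expRN lnK// posrE.
  by rewrite addr_gt0 ?expR_gt0.
apply: measurableT_comp => //; apply: measurableT_comp => //.
apply: measurableT_comp; first exact: measurable_ln.
by apply: measurable_funD => //; apply: measurableT_comp => //; exact: measurable_funM.
Qed.

Lemma bmeas_psiX (y : R) : bmeas (psiX y).
Proof.
apply: (@bmeas_itv _ _ _ _ 0 1); first exact: measurable_psiX.
by move=> v; rewrite (ltW (psiX_gt0 _ _)) psiX_le1.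
Qed.

(** Multiplicative form of [|ln w v - ln w v'| <= L |v - v'|] for positive [w]; this form is stable
    under averaging. *)
Definition log_lipschitz (L : R) (w : R -> R) :=
  forall v v', expR (- (L * `|v - v'|)) * w v <= w v'.

(** After inversion the claim is [1 + exp (y v') <= exp |v - v'| (1 + exp (y v))], which holds term
    by term because [|y| = 1]. *)
Lemma psiX_log_lipschitz (y : R) : y = -1 \/ y = 1 -> log_lipschitz 1 (psiX y).
Proof.
move=> y1 v v'; rewrite mul1r /psiX expRN -invfM.
have pos x : 0 < 1 + expR x by rewrite addr_gt0 ?expR_gt0.
rewrite lef_pV2 ?posrE ?mulr_gt0 ?expR_gt0//.
rewrite mulrDr mulr1 -expRD lerD//; first by rewrite -expR0 ler_expR.
rewrite ler_expR -lerBlDr -mulrBr.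
have := ler_norm (v' - v); have := ler_norm (v - v'); rewrite (distrC v').
by case: y1 => ->; lra.
Qed.

Lemma log_lipschitzM (L L' : R) (w w' : R -> R) :
  (forall v, 0 <= w v) -> (forall v, 0 <= w' v) ->
  log_lipschitz L w -> log_lipschitz L' w' ->
  log_lipschitz (L + L') (fun v => w v * w' v).
Proof.
move=> w0 w'0 Lw Lw' v v'; rewrite mulrDl opprD expRD mulrACA.
by apply: ler_pM => //; rewrite mulr_ge0 ?expR_ge0.
Qed.

End exponential_modulus.

Section clamp.
Context (R : realType).

(** Projection on [[- l, l]] for [l >= 0]. Composing a test function with it leaves integrals
    against laws carried by [[- l, l]] unchanged and makes bounds valid on that interval hold
    everywhere. *)
Definition clamp (l x : R) : R := Num.max (- l) (Num.min x l).

Lemma clamp_id l x : `|x| <= l -> clamp l x = x.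
Proof.
by rewrite ler_norml /clamp => /andP[h1 h2]; rewrite (min_idPl h2) (max_idPr h1).
Qed.

Lemma norm_clamp l x : 0 <= l -> `|clamp l x| <= l.
Proof.
move=> l0; rewrite ler_norml /clamp le_max lexx/= ge_max ge_min lexx orbT andbT.
by lra.
Qed.

Lemma measurable_clamp l : measurable_fun setT (clamp l : Rm R -> Rm R).
Proof. by apply: measurable_maxr => //; exact: measurable_minr. Qed.

End clamp.

Lemma measurable_fun_div_gt0 d (T : measurableType d) (R : realType)
    (f g : T -> R) : measurable_fun setT f -> measurable_fun setT g ->
  (forall x, 0 < g x) -> measurable_fun setT (fun x => f x / g x).
Proof.
move=> mf mg g0; have -> : (fun x => f x / g x) = fun x => f x * expR (- ln (g x)).
  by apply/funext => x; rewrite expRN lnK// posrE.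
apply: measurable_funM => //; apply: measurableT_comp => //.
by apply: measurableT_comp => //; exact: measurableT_comp.
Qed.

Definition carried_by (R : realType) (l : R) (q : probability (Rm R) R) :=
  q (~` [set x | `|x| <= l]) = 0%E.

Lemma measurable_norm_le d (T : measurableType d) (R : realType) (l : R)
  (f : T -> R) : measurable_fun setT f -> measurable [set x | `|f x| <= l].
Proof.
move=> mf; rewrite -[X in measurable X]setTI.
have -> : [set x | `|f x| <= l] = (fun x => `|f x|) @^-1` `]-oo, l]%classic.
  by apply/seteqP; split => x /=; rewrite in_itv.
by apply: (measurableT_comp (f := @Num.norm R R)).
Qed.

(** * Backward recursion and its contraction *)

Section backward.
Context (R : realType) (q : probability (Rm R) R) (rho l : R) (y : nat -> R).
Hypotheses (rho1 : `|rho| < 1) (l0 : 0 <= l) (ql : carried_by l q).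
Hypothesis hy : forall k, (1 <= k)%N -> y k = -1 \/ y k = 1.
Implicit Types (h : R -> R) (u : R).

Let tau := `|rho|.
Let l' := l / (1 - tau).
Let L := (1 - tau)^-1.

Let tau0 : 0 <= tau. Proof. exact: normr_ge0. Qed.
Let tau1 : 0 < 1 - tau. Proof. by rewrite subr_gt0. Qed.

Lemma Rintegral_clamp (h : Rm R -> R) : bmeas h -> \int[q]_x h x = \int[q]_x h (clamp l x).
Proof.
move=> bh.
have bhc : bmeas (fun x => h (clamp l x)).
  by apply: bmeas_comp bh; exact: measurable_clamp.
rewrite /Rintegral; congr fine; apply: ae_eq_integral => //.
- by apply/measurable_EFinP; case: bh.
- by apply/measurable_EFinP; case: bhc.
exists (~` [set x | `|x| <= l]); split => //.
- by apply: measurableC; exact: (@measurable_norm_le _ (Rm R) R l id).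
- move=> x /= hx xl; apply: hx => _; by rewrite clamp_id.
Qed.

Lemma measurable_signal_step (u : R) :
  measurable_fun setT (fun x : Rm R => rho * u + x).
Proof. exact: measurable_funD. Qed.

Lemma bmeas_signal_step h u : bmeas h -> bmeas (fun x : Rm R => h (rho * u + x)).
Proof. by apply: bmeas_comp; exact: measurable_signal_step. Qed.

Lemma bmeas_mean_step h : bmeas h -> bmeas (fun u => \int[q]_x h (rho * u + x)).
Proof.
move=> bh; apply: (@bmeas_Rintegral _ _ _ _ _ q
  (fun p : R * Rm R => h (rho * p.1 + p.2))).
apply: bmeas_comp bh; apply: measurable_funD => //.
by apply: measurable_funM => //; exact: measurable_fst.
Qed.

(** [l'] solves [l' = tau l' + l], so [[- l', l']] is invariant under the signal recursion. *)
Lemma norm_signal_step u x : `|u| <= l' -> `|x| <= l -> `|rho * u + x| <= l'.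
Proof.
move=> ul xl; rewrite (le_trans (ler_normD _ _))// normrM -/tau.
have -> : l' = tau * l' + l by rewrite /l'; field; rewrite gt_eqF.
by rewrite lerD// ler_wpM2l.
Qed.

(** With the same noise [x] on both sides, the two arguments of [h] are at distance
    [tau |u - u'|]. *)
Lemma mean_step_log_lipschitz (K : R) h : bmeas h -> log_lipschitz K h ->
  log_lipschitz (K * tau) (fun u => \int[q]_x h (rho * u + x)).
Proof.
move=> bh Lh u u'; have pl := positive_linear_Rintegral q.
rewrite -(pl_scale pl); last exact: bmeas_signal_step.
apply: (pl_le pl); [|exact: bmeas_signal_step|].
  by apply: bmeasZ; exact: bmeas_signal_step.
move=> x; apply: le_trans (Lh (rho * u + x) (rho * u' + x)).
have -> : rho * u + x - (rho * u' + x) = rho * (u - u') by ring.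
by rewrite normrM mulrA.
Qed.

Section contraction.
Variables (w P : R -> R) (D B : R).
Hypotheses (bw : bmeas w) (bP : bmeas P) (w0 : forall u, 0 < w u).
Hypotheses (Lw : log_lipschitz L w) (D0 : 0 <= D) (B0 : 0 < B).
Hypothesis LB : (2 * L + B) * tau <= (1 + tau) / 2 * B.
Hypothesis PB : forall u u', `|u| <= l' -> `|u'| <= l' ->
  `|P u - P u'| <= D * (1 - expR (- (B * `|u - u'|))).

(** The factor of [expN_contract] for [S = 2 l' B] and [beta = (1 + tau) / 2]; two points of
    [[- l', l']] are at distance at most [2 l']. *)
Let kappa := 1 - expR (- (2 * l' * B)) * ((1 - tau) / 2).

(** Coupling estimate [tilted_mean_diff] with common noise: on success the two states are at
    distance [tau r], otherwise only the global bound [D] is available. The absolute value is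
    obtained later by exchanging [u] and [u']. *)
Let half u u' : `|u| <= l' -> `|u'| <= l' ->
  (\int[q]_x (w (rho * u + x) * P (rho * u + x))) / (\int[q]_x w (rho * u + x)) -
  (\int[q]_x (w (rho * u' + x) * P (rho * u' + x))) / (\int[q]_x w (rho * u' + x))
  <= kappa * D * (1 - expR (- (B * `|u - u'|))).
Proof.
move=> ul u'l; set r := `|u - u'|.
have bs v h : bmeas h -> bmeas (fun x : Rm R => h (rho * v + clamp l x)).
  by move=> bh; exact: (bmeas_comp (measurable_clamp l) (bmeas_signal_step v bh)).
have cE v h : bmeas h ->
    \int[q]_x h (rho * v + x) = \int[q]_x h (rho * v + clamp l x).
  move=> bh; apply: (@Rintegral_clamp (fun x => h (rho * v + x))).
  exact: bmeas_signal_step.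
have bwP : bmeas (fun v => w v * P v) by exact: bmeasM.
rewrite !(cE _ _ bw) (cE _ _ bwP) (cE _ _ bwP).
have ns v x : `|v| <= l' -> `|rho * v + clamp l x| <= l'.
  by move=> vl; apply: norm_signal_step => //; exact: norm_clamp.
(* One factor [exp (- L tau r)] bounds the change of [w], the other that of its normalising
   integral. *)
pose theta := expR (- (2 * L * tau * r)).
have L0 : 0 < L by rewrite invr_gt0.
have r0 : 0 <= r by exact: normr_ge0.
have rd x : `|(rho * u + clamp l x) - (rho * u' + clamp l x)| = tau * r.
  by rewrite /r /tau -normrM; congr (`|_|); ring.
(* The left side equals [D (1 - exp (- (2 L + B) tau r))]; [LB] bounds the rate by
   [(1 + tau) / 2 * B], after which [expN_contract] applies. *)
have hD : (1 - theta) * D + theta * (D * (1 - expR (- (B * (tau * r))))) <=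
    kappa * D * (1 - expR (- (B * r))).
  have e : theta * expR (- (B * (tau * r))) = expR (- ((2 * L + B) * tau * r)).
    by rewrite -expRD; congr expR; ring.
  have h1 : 1 - expR (- ((2 * L + B) * tau * r)) <=
      1 - expR (- ((1 + tau) / 2 * (B * r))).
    rewrite lerD2l lerN2 ler_expR lerN2 [leRHS]mulrA.
    by rewrite ler_wpM2r.
  have h2 : 1 - expR (- ((1 + tau) / 2 * (B * r))) <=
      kappa * (1 - expR (- (B * r))).
    have -> : kappa = 1 - expR (- (2 * l' * B)) * (1 - (1 + tau) / 2).
      by rewrite /kappa; congr (1 - _ * _); field.
    apply: expN_contract.
      rewrite mulr_ge0 ?(ltW B0)//= mulrC ler_wpM2r ?(ltW B0)//.
      by rewrite (le_trans (ler_normB _ _))// mulrDl mul1r lerD.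
    by move: tau0 tau1; lra.
  have -> : (1 - theta) * D + theta * (D * (1 - expR (- (B * (tau * r))))) =
      D * (1 - theta * expR (- (B * (tau * r)))) by ring.
  by rewrite e [kappa * D]mulrC -[D * kappa * _]mulrA ler_wpM2l// (le_trans h1).
apply: le_trans hD.
have wc v x : 0 < w (rho * v + clamp l x) by exact: w0.
apply: tilted_mean_diff => //.
- exact: bs.
- exact: bs.
- exact: bs.
- exact: bs.
- rewrite expR_ge0/= -expR0 ler_expR oppr_le0.
  by rewrite !mulr_ge0// ltW.
- move=> x.
  have A0 v := Rintegral_gt0 q (bs v w bw) (wc v).
  have h1 : expR (- (L * tau * r)) * w (rho * u + clamp l x) <=
      w (rho * u' + clamp l x).
    by have := Lw (rho * u + clamp l x) (rho * u' + clamp l x); rewrite rd mulrA.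
  have h2 : expR (- (L * tau * r)) * (\int[q]_x w (rho * u' + clamp l x)) <=
      \int[q]_x w (rho * u + clamp l x).
    have := mean_step_log_lipschitz bw Lw u' u.
    by rewrite !(cE _ _ bw) distrC.
  rewrite ler_pdivlMr// [theta * _]mulrA mulrAC ler_pdivrMr//.
  have -> : theta = expR (- (L * tau * r)) * expR (- (L * tau * r)).
    by rewrite -expRD; congr expR; ring.
  rewrite [X in X <= _](_ : _ =
    expR (- (L * tau * r)) * w (rho * u + clamp l x) *
    (expR (- (L * tau * r)) * \int[q]_x w (rho * u' + clamp l x))); last by ring.
  apply: ler_pM => //.
  + by rewrite mulr_ge0 ?expR_ge0 ?ltW.
  + by rewrite mulr_ge0 ?expR_ge0 ?ltW.
- move=> x t; rewrite -lerBlDl (le_trans (ler_norm _))//.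
  apply: le_trans (PB (ns u x ul) (ns u' t u'l)) _.
  by rewrite -[leRHS]mulr1 ler_wpM2l// gerBl expR_ge0.
- move=> x; rewrite -lerBlDl (le_trans (ler_norm _))//.
  by apply: le_trans (PB (ns u x ul) (ns u' x u'l)) _; rewrite rd.
Qed.

Lemma tilted_step_contraction u u' : `|u| <= l' -> `|u'| <= l' ->
  `|(\int[q]_x (w (rho * u + x) * P (rho * u + x))) / (\int[q]_x w (rho * u + x)) -
  (\int[q]_x (w (rho * u' + x) * P (rho * u' + x))) / (\int[q]_x w (rho * u' + x))|
  <= kappa * D * (1 - expR (- (B * `|u - u'|))).
Proof.
move=> ul u'l; rewrite ler_norml lerNl opprB; apply/andP; split.
  by rewrite distrC; exact: half.
exact: half.
Qed.

End contraction.

(* [j] steps remain after time [k]: [backward j k h x] is the expectation of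
   [Psi_{k+1} ... Psi_{k+j} h(X_{k+j})] given [X_k = x]. *)
Fixpoint backward (j k : nat) (h : R -> R) : R -> R :=
  if j is i.+1 then
    fun u => \int[q]_x (psiX (y k.+1) (rho * u + x) *
                        backward i k.+1 h (rho * u + x))
  else h.

Lemma bmeas_backward j k h : bmeas h -> bmeas (backward j k h).
Proof.
move=> bh; elim: j k => [//|j IH] k /=.
apply: (bmeas_mean_step (h := fun v => psiX (y k.+1) v * backward j k.+1 h v)).
by apply: bmeasM => //; exact: bmeas_psiX.
Qed.

Let one : R -> R := fun=> 1.

Let bone : bmeas one. Proof. exact: bmeas_cst. Qed.

Lemma backward_gt0 j k u : 0 < backward j k one u.
Proof.
elim: j k u => [|j IH] k u /=; first exact: ltr01.
apply: Rintegral_gt0 => [|x]; last by rewrite mulr_gt0// psiX_gt0.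
apply: (bmeas_signal_step (h := fun v => psiX (y k.+1) v * backward j k.+1 one v)).
by apply: bmeasM; [exact: bmeas_psiX|exact: bmeas_backward].
Qed.

(** [L] solves [L = 1 + L tau]: the factor [psiX] contributes 1 and averaging the next potential
    over one step contributes [L tau], so the constant does not grow with the horizon [j]. *)
Lemma backward_potential_log_lipschitz j k :
  log_lipschitz L (fun v => psiX (y k.+1) v * backward j k.+1 one v).
Proof.
have -> : L = 1 + L * tau by rewrite /L; field; rewrite gt_eqF.
elim: j k => [|j IH] k.
  apply: log_lipschitzM.
  - by move=> v; rewrite ltW ?psiX_gt0.
  - by move=> v; rewrite ltW ?backward_gt0.
  - by apply: psiX_log_lipschitz; exact: hy.
  - move=> v v' /=; rewrite /one mulr1 -expR0 ler_expR oppr_le0.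
    by rewrite !mulr_ge0// invr_ge0 ltW.
apply: log_lipschitzM.
- by move=> v; rewrite ltW ?psiX_gt0.
- by move=> v; rewrite ltW ?backward_gt0.
- by apply: psiX_log_lipschitz; exact: hy.
- apply: (mean_step_log_lipschitz (h := fun v => psiX (y k.+2) v *
    backward j k.+2 one v)).
    by apply: bmeasM; [exact: bmeas_psiX|exact: bmeas_backward].
  have -> : L = 1 + L * tau by rewrite /L; field; rewrite gt_eqF.
  exact: IH.
Qed.

Variables (g : R -> R) (D B : R).
Hypotheses (bg : bmeas g) (D0 : 0 <= D) (B0 : 0 < B).
Hypothesis LB : (2 * L + B) * tau <= (1 + tau) / 2 * B.
Hypothesis gB : forall u u', `|u| <= l' -> `|u'| <= l' ->
  `|g u - g u'| <= D * (1 - expR (- (B * `|u - u'|))).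

Let kappa := 1 - expR (- (2 * l' * B)) * ((1 - tau) / 2).

Lemma kappa_itv : 0 < kappa < 1.
Proof.
have e1 : expR (- (2 * l' * B)) <= 1.
  have l'0 : 0 <= l' by rewrite divr_ge0// ltW.
  by rewrite -expR0 ler_expR oppr_le0 (mulr_ge0 (mulr_ge0 _ l'0) (ltW B0)).
have e0 : 0 < expR (- (2 * l' * B)) by exact: expR_gt0.
rewrite /kappa; move: tau0 tau1 => *.
by apply/andP; split; nra.
Qed.

(** By Bayes' rule, the conditional mean of [g X_{k+j}] given [X_k = u] and the observations
    [y_{k+1}, ..., y_{k+j}]. *)
Definition backward_mean j k u := backward j k g u / backward j k one u.

Lemma norm_backward_le M j k u : (forall v, `|g v| <= M) ->
  `|backward j k g u| <= M * backward j k one u.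
Proof.
move=> gM; elim: j k u => [|j IH] k u /=; first by rewrite mulr1.
have pl := positive_linear_Rintegral q.
have b1 h : bmeas h -> bmeas (fun x : Rm R =>
    psiX (y k.+1) (rho * u + x) * backward j k.+1 h (rho * u + x)).
  move=> bh; apply: (bmeas_signal_step (h := fun v => psiX (y k.+1) v *
    backward j k.+1 h v)).
  by apply: bmeasM; [exact: bmeas_psiX|exact: bmeas_backward].
rewrite (le_trans (le_normr_Rintegral _ (bmeas_integrable q (b1 _ bg))))//.
rewrite -(pl_scale pl); last exact: b1.
apply: (pl_le pl); [exact/bmeas_norm/b1|exact/bmeasZ/b1|].
move=> x; rewrite normrM mulrCA gtr0_norm ?psiX_gt0//.
by rewrite ler_wpM2l// ltW// psiX_gt0.
Qed.

Lemma bmeas_backward_mean j k : bmeas (backward_mean j k).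
Proof.
split.
  apply: measurable_fun_div_gt0; last by move=> x; exact: backward_gt0.
    by case: (bmeas_backward j k bg).
  by case: (bmeas_backward j k bone).
have [M M0 gM] := bmeas_gt0 bg; exists M => u.
rewrite normrM normfV [`|backward _ _ one _|]gtr0_norm ?backward_gt0//.
by rewrite ler_pdivrMr ?backward_gt0// norm_backward_le.
Qed.

(** A backward step is a mean tilted by the potential [w], to which [tilted_step_contraction]
    applies with [kappa ^+ j * D] in place of [D]. *)
Lemma backward_mean_contraction j k u u' : `|u| <= l' -> `|u'| <= l' ->
  `|backward_mean j k u - backward_mean j k u'| <=
  kappa ^+ j * D * (1 - expR (- (B * `|u - u'|))).
Proof.
elim: j k u u' => [|j IH] k u u' ul u'l.
  by rewrite /backward_mean /= /one !divr1 expr0 mul1r; exact: gB.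
pose w v := psiX (y k.+1) v * backward j k.+1 one v.
have bw : bmeas w by apply: bmeasM; [exact: bmeas_psiX|exact: bmeas_backward].
have w0 v : 0 < w v by rewrite mulr_gt0 ?psiX_gt0 ?backward_gt0.
have kD0 : 0 <= kappa ^+ j * D.
  by have /andP[k0 _] := kappa_itv; rewrite mulr_ge0 ?exprn_ge0 ?(ltW k0).
(* Multiplying and dividing by [backward j k.+1 one] exhibits the numerator as the [w]-weighted
   integral of the next mean. *)
have E v : backward_mean j.+1 k v =
    (\int[q]_x (w (rho * v + x) * backward_mean j k.+1 (rho * v + x))) /
    (\int[q]_x w (rho * v + x)).
  rewrite /backward_mean /=; congr (_ / _); apply: eq_Rintegral => x _.
  rewrite /w -mulrA; congr (_ * _); rewrite [RHS]mulrC divfK//.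
  by rewrite gt_eqF// backward_gt0.
rewrite !E exprS -[kappa * _ * D]mulrA.
exact: (tilted_step_contraction bw (bmeas_backward_mean j k.+1) w0
  (backward_potential_log_lipschitz j k) kD0 B0 LB (IH k.+1)).
Qed.

End backward.

(** * Monte Carlo error *)

Section exchangeable_sampling.
Context d (T : measurableType d) (R : realType) (P : probability T R).
Variables (N : nat) (H : 'I_N -> set T) (p : T -> R).
Hypotheses (N0 : (0 < N)%N) (mH : forall i, measurable (H i)).
Hypotheses (mp : measurable_fun setT p) (p01 : forall w, 0 <= p w <= 1).
Hypothesis Hp : forall i a, P ([set w | a <= p w] `&` H i) =
  (\int[P]_(w in [set w | (a <= p w)%R]) (p w)%:E)%E.
Hypothesis Hpp : forall i j, i != j ->
  P (H i `&` H j) = (\int[P]_w (p w ^+ 2)%:E)%E.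

Let pl := positive_linear_Rintegral P.
Let bp : bmeas p. Proof. exact: bmeas_itv mp p01. Qed.
Let bH i : bmeas (\1_(H i) : T -> R). Proof. exact: bmeas_indic. Qed.
Let bsup a : bmeas (\1_[set w | a <= p w] : T -> R).
Proof. by apply: bmeas_indic; exact: measurable_superlevel. Qed.

Let layersE J : (fun w => layers J (p w)) =
  fun w => J%:R^-1 * \sum_(j < J) \1_[set w | j.+1%:R / J%:R <= p w] w.
Proof.
apply/funext => w; rewrite /layers; congr (_ * _).
by apply: eq_bigr => j _; rewrite indicE mem_setE.
Qed.

Let blayers J : bmeas (fun w => layers J (p w)).
Proof. by rewrite layersE; apply: bmeasZ; apply: bmeas_sum => j. Qed.

Let mean_layers J (h : T -> R) : (0 < J)%N -> bmeas h ->
  (forall w, 0 <= h w <= 1) ->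
  \int[P]_w (h w * layers J (p w)) <= \int[P]_w (h w * p w) <=
  \int[P]_w (h w * layers J (p w)) + J%:R^-1.
Proof.
move=> J0 bh h01.
have bhl : bmeas (fun w => h w * layers J (p w)) by exact: bmeasM.
apply/andP; split.
  apply: (pl_le pl) => //; first exact: bmeasM.
  move=> w; have /andP[h0 _] := h01 w; have /andP[lp _] := layers_itv J0 (p01 w).
  exact: ler_wpM2l.
rewrite -(Rintegral_probability_cst P J%:R^-1) -(pl_add pl)//; last first.
  exact: bmeas_cst.
apply: (pl_le pl); [exact: bmeasM|apply: bmeasD => //; exact: bmeas_cst|].
move=> w; have /andP[h0 h1] := h01 w; have /andP[_ lp] := layers_itv J0 (p01 w).
apply: le_trans (ler_wpM2l h0 lp) _.
by rewrite mulrDr lerD2l ler_piMl.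
Qed.

Let ind01 (A : set T) w : 0 <= (\1_A w : R) <= 1.
Proof. by rewrite indicE; case: (_ \in _); rewrite /= ?lexx ?ler01. Qed.

Let mean_superlevel i a : \int[P]_w (\1_(H i) w * \1_[set w | a <= p w] w) =
  \int[P]_w (p w * \1_[set w | a <= p w] w).
Proof.
rewrite (_ : (fun w => \1_(H i) w * _) = \1_([set w | a <= p w] `&` H i)).
  rewrite Rintegral_indic; last first.
    by apply: measurableI => //; exact: measurable_superlevel.
  rewrite Hp -/(Rintegral P [set w | a <= p w] p) [LHS]Rintegral_mkcond/=.
  by apply: eq_Rintegral => w _; rewrite patchE indicE; case: ifPn;
    rewrite ?mulr1 ?mulr0.
by apply/funext => w; rewrite setIC indicI.
Qed.

Let mean_event_layers J i :
  \int[P]_w (\1_(H i) w * layers J (p w)) = \int[P]_w (p w * layers J (p w)).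
Proof.
have E (h : T -> R) : bmeas h -> \int[P]_w (h w * layers J (p w)) =
    J%:R^-1 * \sum_(j < J) \int[P]_w (h w * \1_[set w | j.+1%:R / J%:R <= p w] w).
  move=> bh; rewrite -(pl_sum pl); last by move=> j; exact: bmeasM.
  rewrite -(pl_scale pl); last by apply: bmeas_sum => j; exact: bmeasM.
  apply: eq_Rintegral => w _; have /(congr1 (@^~ w)) /= -> := layersE J.
  by rewrite mulrCA mulr_sumr.
rewrite !E//; congr (_ * _); apply: eq_bigr => j _; exact: mean_superlevel.
Qed.

(* The hypothesis only gives the conditional probability of [H i] on superlevel
   sets of [p]; layering [p] turns it into a covariance. *)
Let mean_event_p i : \int[P]_w (\1_(H i) w * p w) = \int[P]_w (p w * p w).
Proof.
apply/eqP; rewrite eq_le -subr_le0 -[X in _ && X]subr_le0; apply/andP; split;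
  apply: (@le0_of_le_invn _ _ 1) => J J0;
  have /andP[a1 a2] := mean_layers J0 (bH i) (ind01 (H i));
  have /andP[b1 b2] := mean_layers J0 bp p01;
  by move: a1 a2 b1 b2; rewrite mean_event_layers mul1r; lra.
Qed.

(** By [mean_event_p] and [Hpp], each of the four terms of the expanded product integrates, up to
    sign, to the second moment of [p], and the signs sum to 0. *)
Let mean_cov i j : i != j ->
  \int[P]_w ((\1_(H i) w - p w) * (\1_(H j) w - p w)) = 0.
Proof.
move=> ij.
rewrite (_ : (fun w => _) = fun w => \1_(H i) w * \1_(H j) w -
    \1_(H i) w * p w - \1_(H j) w * p w + p w * p w); last first.
  by apply/funext => w; ring.
have bm f g : bmeas f -> bmeas g -> bmeas (fun w => f w * g w : R).
  exact: bmeasM.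
rewrite (pl_add pl); [|by repeat (apply: bmeasB => //); exact: bm|exact: bm].
rewrite (plB pl); [|by apply: bmeasB; exact: bm|exact: bm].
rewrite (plB pl); [|exact: bm|exact: bm].
rewrite !mean_event_p (_ : \int[P]_w (_ * \1_(H j) w) = \int[P]_w (p w * p w)).
  by ring.
rewrite (_ : (fun w => _ * _) = \1_(H i `&` H j)); last first.
  by apply/funext => w; rewrite indicI.
by rewrite Rintegral_indic ?Hpp//; exact: measurableI.
Qed.

Let S w : R := N%:R^-1 * \sum_(i < N) \1_(H i) w.

(** Off-diagonal covariances vanish and each diagonal term is at most 1, so the second moment of
    [S - p] is at most [1 / N]; the first moment follows. *)
Lemma mean_sampling_error : \int[P]_w `|S w - p w| <= (Num.sqrt N%:R)^-1.
Proof.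
have N0R : 0 < N%:R :> R by rewrite ltr0n.
have sN0 : 0 < Num.sqrt N%:R :> R by rewrite sqrtr_gt0.
have sNN : Num.sqrt N%:R * Num.sqrt N%:R = N%:R :> R.
  by rewrite -expr2 sqr_sqrtr// ltW.
have SE w : S w - p w = N%:R^-1 * \sum_(i < N) (\1_(H i) w - p w).
  rewrite sumrB mulrBr; congr (_ - _).
  by rewrite sumr_const card_ord -[p w *+ N]mulr_natl mulrA mulVf ?mul1r// gt_eqF.
have bS : bmeas (fun w => S w - p w).
  by apply: bmeasB => //; apply: bmeasZ; exact: bmeas_sum.
have bc i : bmeas (fun w => \1_(H i) w - p w) by exact: bmeasB.
have var : \int[P]_w ((S w - p w) * (S w - p w)) <= N%:R^-1.
  rewrite (_ : (fun w => _) = fun w => N%:R^-1 * (N%:R^-1 *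
      \sum_(i < N) \sum_(j < N) ((\1_(H i) w - p w) * (\1_(H j) w - p w)))).
    have bij i j : bmeas (fun w => (\1_(H i) w - p w) * (\1_(H j) w - p w)).
      exact: bmeasM.
    have bi i : bmeas (fun w => \sum_(j < N)
        ((\1_(H i) w - p w) * (\1_(H j) w - p w))) by exact: bmeas_sum.
    have bb := bmeas_sum (index_enum 'I_N) bi.
    rewrite (pl_scale pl); last exact: bmeasZ.
    rewrite (pl_scale pl)// (pl_sum pl)// -[leRHS]mulr1 ler_wpM2l ?invr_ge0//.
    rewrite ler_pdivrMl// mulr1.
    have -> : N%:R = \sum_(i < N) (1 : R).
      by rewrite sumr_const card_ord.
    apply: ler_sum => i _; rewrite (pl_sum pl)// (bigD1 i)//= big1 ?addr0.
      rewrite -[leRHS](Rintegral_probability_cst P).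
      apply: (pl_le pl) => //; first exact: bmeas_cst.
      move=> w; have /andP[p0 p1] := p01 w; have /andP[h0 h1] := ind01 (H i) w.
      by nra.
    by move=> j ji; rewrite mean_cov// eq_sym.
  apply/funext => w; rewrite SE mulrACA -mulrA; congr (_ * (_ * _)).
  by rewrite mulr_suml; apply: eq_bigr => i _; rewrite mulr_sumr.
(* AM-GM: [2 |x| <= sqrt N x^2 + 1 / sqrt N] *)
have le w : `|S w - p w| <= Num.sqrt N%:R / 2 * ((S w - p w) * (S w - p w)) +
    (Num.sqrt N%:R)^-1 / 2.
  rewrite -[X in _ * X]expr2 -real_normK ?num_real//.
  set x := `|_|; have x0 : 0 <= x by exact: normr_ge0.
  have : 0 <= (Num.sqrt N%:R * x - 1) ^+ 2 / Num.sqrt N%:R.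
    by rewrite divr_ge0 ?sqr_ge0// ltW.
  have -> : (Num.sqrt N%:R * x - 1) ^+ 2 / Num.sqrt N%:R =
    Num.sqrt N%:R * x ^+ 2 - 2 * x + (Num.sqrt N%:R)^-1.
    by field; rewrite gt_eqF.
  by lra.
have bSS : bmeas (fun w => (S w - p w) * (S w - p w)) by exact: bmeasM.
apply: (@le_trans _ _ (\int[P]_w (Num.sqrt N%:R / 2 *
    ((S w - p w) * (S w - p w)) + (Num.sqrt N%:R)^-1 / 2))).
  apply: (pl_le pl) => //; first exact: bmeas_norm.
  by apply: bmeasD; [exact: bmeasZ|exact: bmeas_cst].
rewrite (pl_add pl); [|exact: bmeasZ|exact: bmeas_cst].
rewrite (pl_scale pl)// Rintegral_probability_cst.
have : Num.sqrt N%:R / 2 * \int[P]_w ((S w - p w) * (S w - p w)) <=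
    Num.sqrt N%:R / 2 * N%:R^-1.
  by rewrite ler_wpM2l// divr_ge0// ltW.
have -> : Num.sqrt N%:R / 2 * N%:R^-1 = (Num.sqrt N%:R)^-1 / 2 :> R.
  by rewrite -{2}sNN; field; rewrite gt_eqF.
by lra.
Qed.

End exchangeable_sampling.

(** * Filter and particle recursions *)

Section path_functionals.
Context (R : realType).

(** The new noise is the term [k = 0], and every older one gains a factor [rho]. *)
Lemma path_X_rcons rho n (lam : traj R n) x :
  path_X rho (path_rcons lam x) = rho * path_X rho lam + x.
Proof.
rewrite /path_X big_ord_recl expr0 mul1r addrC mulr_sumr; congr (_ + _).
  apply: eq_bigr => k _; rewrite exprS -mulrA; congr (_ * (_ * _)).
  rewrite !(tnth_nth 0)/= nth_rcons size_tuple /bump/= add1n subSS.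
  by rewrite subSS ltnS leq_subr.
by rewrite (tnth_nth 0)/= nth_rcons size_tuple subSS subn0 ltnn eqxx.
Qed.

Lemma path_X0 rho (x : R) : path_X rho (path0 x) = x.
Proof. by rewrite /path_X big_ord1 expr0 mul1r (tnth_nth 0). Qed.

Lemma measurable_path_X rho n : measurable_fun setT (@path_X R rho n).
Proof.
apply: measurable_sum => k; apply: measurable_funM => //.
exact: measurable_tnth.
Qed.

Lemma psi_gt0 rho y n (lam : traj R n) : 0 < psi rho y lam.
Proof. exact: psiX_gt0. Qed.

Lemma bmeas_psi rho y n : bmeas (@psi R rho y n).
Proof. by apply: bmeas_comp (bmeas_psiX y); exact: measurable_path_X. Qed.

Section predict.
Variable q : probability (Rm R) R.

(** The kernel [Qbar] acting on test functions, for the constant kernel [q]. *)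
Definition predict n (f : traj R n.+1 -> R) (lam : traj R n) : R :=
  \int[q]_x f (path_rcons lam x).

Lemma bmeas_rcons n (f : traj R n.+1 -> R) (lam : traj R n) :
  bmeas f -> bmeas (fun x : Rm R => f (path_rcons lam x)).
Proof. by apply: bmeas_comp; exact: measurable_path_rconsr. Qed.

Lemma bmeas_predict n (f : traj R n.+1 -> R) : bmeas f -> bmeas (predict f).
Proof.
move=> bf; apply: (@bmeas_Rintegral _ _ _ _ _ q
  (fun p : traj R n * Rm R => f (path_rcons p.1 p.2))).
exact: (bmeas_comp (@measurable_path_rcons R n)).
Qed.

Lemma predict_path_X rho n (h : R -> R) (lam : traj R n) :
  predict (fun lam' => h (path_X rho lam')) lam =
  \int[q]_x h (rho * path_X rho lam + x).
Proof. by apply: eq_Rintegral => x _; rewrite path_X_rcons. Qed.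

Lemma predict_gt0 n (f : traj R n.+1 -> R) lam :
  bmeas f -> (forall lam', 0 < f lam') -> 0 < predict f lam.
Proof. by move=> bf f0; apply: Rintegral_gt0 => //; exact: bmeas_rcons. Qed.

Lemma positive_linear_predict n (mu : probability (traj R n) R) :
  positive_linear (fun f => \int[mu]_lam predict f lam).
Proof.
have pq := positive_linear_Rintegral q; have pm := positive_linear_Rintegral mu.
split=> [f g bf bg|a f bf|f g bf bg fg].
- rewrite -(pl_add pm); try exact: bmeas_predict.
  by apply: eq_Rintegral => lam _; rewrite /predict (pl_add pq)//; exact: bmeas_rcons.
- rewrite -(pl_scale pm); last exact: bmeas_predict.
  by apply: eq_Rintegral => lam _; rewrite /predict (pl_scale pq)//; exact: bmeas_rcons.
- apply: (pl_le pm); try exact: bmeas_predict.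
  by move=> lam; apply: (pl_le pq) => //; exact: bmeas_rcons.
Qed.

End predict.

Lemma positive_linear_tilt d (X : measurableType d) (L : (X -> R) -> R)
    (w : X -> R) (Z : R) :
  positive_linear L -> bmeas w -> (forall x, 0 <= w x) -> 0 <= Z ->
  positive_linear (fun f => L (fun x => w x * f x) / Z).
Proof.
move=> pl bw w0 Z0; split=> [f g bf bg|a f bf|f g bf bg fg].
- rewrite -mulrDl; congr (_ / _); rewrite -(pl_add pl); try exact: bmeasM.
  by congr L; apply/funext => x; rewrite mulrDr.
- rewrite mulrA; congr (_ / _); rewrite -(pl_scale pl); last exact: bmeasM.
  by congr L; apply/funext => x; rewrite mulrCA.
- rewrite ler_wpM2r ?invr_ge0//; apply: (pl_le pl); try exact: bmeasM.
  by move=> x; rewrite ler_wpM2l.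
Qed.

(** A total mass that is real and nonzero keeps [mnormalize] away from its default value. *)
Lemma normalizeE n (nu : {measure set (traj R n) -> \bar R}) (A : set (traj R n))
    (a b : R) : nu A = a%:E -> nu setT = b%:E -> b != 0 ->
  fine (normalize nu A) = a / b.
Proof.
move=> nuA nuT b0; rewrite /normalize /= /mnormalize nuT /= eqe (negbTE b0)/=.
by rewrite nuA.
Qed.

(** The weights [1 / N] of the empirical measure cancel in the normalisation, which leaves a
    self-normalised average of [f] with weights [psi]. *)
Lemma Rintegral_reweight_empirical rho y n N (z : 'I_N -> traj R n) f :
  (0 < N)%N -> bmeas f ->
  \int[reweight rho y (empirical R z)]_lam f lam =
  (\sum_(i < N) psi rho y (z i) * f (z i)) / \sum_(i < N) psi rho y (z i).
Proof.
move=> N0 bf.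
have int_emp (g : traj R n -> R) : measurable_fun setT g ->
    (forall lam, 0 <= g lam) ->
    (\int[empirical R z]_lam (g lam)%:E = (N%:R^-1 * \sum_(i < N) g (z i))%:E)%E.
  move=> mg g0; have r0 : 0 <= N%:R^-1 :> R by [].
  pose m (k : nat) : {measure set (traj R n) -> \bar R} :=
    if insub k is Some i then dirac (z i) else mzero.
  (* As a scaled finite sum of Dirac masses, [empirical] can be integrated term by term. *)
  have -> : (\int[empirical R z]_lam (g lam)%:E =
      \int[mscale (NngNum r0) (msum m N)]_lam (g lam)%:E)%E.
    apply: eq_measure_integral => A _ _; rewrite /= /empirical /mscale/= /msum.
    by congr *%E; apply: eq_bigr => i _; rewrite /m valK.
  have mg' : measurable_fun setT (EFin \o g) by exact/measurable_EFinP.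
  rewrite ge0_integral_mscale//; last by move=> lam _; rewrite lee_fin.
  rewrite ge0_integral_measure_sum//; last by move=> lam _; rewrite lee_fin.
  rewrite EFinM -sumEFin; congr *%E; apply: eq_bigr => i _.
  by rewrite /m valK integral_dirac// diracT mul1e.
pose Z := \sum_(i < N) psi rho y (z i).
have sum_gt0 : 0 < Z.
  rewrite /Z; case: N N0 z {int_emp Z} => [//|N] _ z.
  rewrite big_ord_recl ltr_wpDr ?psi_gt0// sumr_ge0// => i _.
  exact: psi_ge0.
have dens A : measurable A ->
    with_density (empirical R z) (@measurable_psi R rho y n) (@psi_ge0 R rho y n) A
    = (N%:R^-1 * \sum_(i < N) psi rho y (z i) * \1_A (z i))%:E.
  move=> mA; rewrite /with_density integral_mkcond.
  rewrite -(int_emp (fun lam => psi rho y lam * \1_A lam)).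
  - apply: eq_integral => lam _; rewrite patchE indicE.
    by case: ifPn; rewrite ?mulr1 ?mulr0.
  - by apply: measurable_funM; [exact: measurable_psi|exact: measurable_indic].
  - by move=> lam; rewrite mulr_ge0 ?psi_ge0.
have N0R : N%:R != 0 :> R by rewrite pnatr_eq0 -lt0n.
apply: (RintegralE (L := fun f =>
    (\sum_(i < N) psi rho y (z i) * f (z i)) / Z)) => //.
  split=> [g h _ _|a g _|g h _ _ gh].
  - rewrite -mulrDl -big_split; congr (_ / _); apply: eq_bigr => i _ /=.
    by rewrite mulrDr.
  - rewrite mulrA mulr_sumr; congr (_ / _); apply: eq_bigr => i _ /=.
    by rewrite mulrCA.
  - rewrite ler_wpM2r ?invr_ge0 ?(ltW sum_gt0)//; apply: ler_sum => i _.
    by rewrite ler_wpM2l ?psi_ge0.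
have psiT : \sum_(i < N) psi rho y (z i) * \1_setT (z i) = Z.
  by apply: eq_bigr => i _; rewrite indicT mulr1.
move=> A mA; rewrite /reweight.
rewrite (normalizeE (dens A mA) (dens _ measurableT)) psiT.
  by rewrite -mulf_div mulfV ?mul1r// invr_neq0.
by apply: mulf_neq0; [exact: invr_neq0|exact: lt0r_neq0].
Qed.

End path_functionals.

Section filter_recursion.
Context (R : realType) (rho : R) (y : nat -> R).
Variables (zeta q : probability (Rm R) R).

Let Q : nat -> R.-pker (Rm R) ~> (Rm R) := fun=> const_kernel q.

Lemma Rintegral_Rstep n (mu : probability (traj R n) R) f : bmeas f ->
  \int[Rstep rho y Q mu]_lam f lam =
  (\int[mu]_lam predict q (fun lam' => psi rho (y n.+1) lam' * f lam') lam) /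
  \int[mu]_lam predict q (@psi R rho (y n.+1) n.+1) lam.
Proof.
move=> bf; have bpsi := @bmeas_psi R rho (y n.+1) n.+1.
have gammaE A : measurable A ->
    gamma (Q n.+1) mu (@measurable_psi R rho (y n.+1) n.+1)
      (@psi_ge0 R rho (y n.+1) n.+1) A =
    (\int[mu]_lam predict q (fun lam' => psi rho (y n.+1) lam' * \1_A lam') lam)%:E.
  move=> mA; rewrite /gamma.
  have bpA : bmeas (fun lam' => psi rho (y n.+1) lam' * \1_A lam' : R).
    by apply: bmeasM => //; exact: bmeas_indic.
  rewrite EFin_Rintegral; last exact: bmeas_predict.
  apply: eq_integral => lam _; rewrite /predict.
  by rewrite (EFin_Rintegral q (bmeas_rcons lam bpA)).
have Z0 : 0 < \int[mu]_lam predict q (@psi R rho (y n.+1) n.+1) lam.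
  apply: Rintegral_gt0 => [|lam]; first exact: bmeas_predict.
  by apply: predict_gt0 => // lam'; exact: psi_gt0.
apply: (RintegralE (L := fun f => (\int[mu]_lam predict q
  (fun lam' => psi rho (y n.+1) lam' * f lam') lam) / _)) => //.
  apply: (positive_linear_tilt (L := fun f => \int[mu]_lam predict q f lam)) => //.
  - exact: positive_linear_predict.
  - exact: psi_ge0.
  - exact: ltW.
have psi1 : (fun lam' => psi rho (y n.+1) lam' * \1_setT lam') =
    @psi R rho (y n.+1) n.+1 by apply/funext => lam; rewrite indicT mulr1.
move=> A mA; rewrite /Rstep (normalizeE (gammaE A mA) (gammaE _ measurableT)) psi1//.
by rewrite gt_eqF.
Qed.

(** Links the probabilities prescribed by [particle_system] to integrals of [predict]. *)
Lemma fine_kact_Qbar n (mu : probability (traj R n) R) A : measurable A ->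
  fine (kact mu (Qbar (const_kernel q) (n := n)) A) =
  \int[mu]_lam predict q \1_A lam.
Proof.
move=> mA; rewrite /kact /Rintegral; congr fine; apply: eq_integral => lam _.
rewrite /predict (EFin_Rintegral q (bmeas_rcons lam (bmeas_indic R mA))).
have mB : measurable (path_rcons lam @^-1` A).
  by rewrite -[X in measurable X]setTI; exact: measurable_path_rconsr.
rewrite (_ : (fun x => (\1_A (path_rcons lam x))%:E) =
    (fun x => (\1_(path_rcons lam @^-1` A) x)%:E)); last exact/funext.
by rewrite integral_indic// setIT.
Qed.

End filter_recursion.

(** * Sampling error of the particle system *)

Section functional_comparison.
Context d (X : measurableType d) (R : realType).
Variables L L' : (X -> R) -> R.
Hypotheses (plL : positive_linear L) (plL' : positive_linear L').
Hypotheses (L1 : L (fun=> 1) = 1) (L'1 : L' (fun=> 1) = 1).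

(** Both functionals increase by an amount in [[0, 1 / J]] when the layered function is replaced by
    [f], so their difference changes by at most [1 / J]. *)
Lemma functional_diff_layers (J : nat) (f : X -> R) : (0 < J)%N ->
  measurable_fun setT f -> (forall x, 0 <= f x <= 1) ->
  `|L f - L' f| <= J%:R^-1 * \sum_(j < J)
    `|L \1_[set x | j.+1%:R / J%:R <= f x] - L' \1_[set x | j.+1%:R / J%:R <= f x]|
    + J%:R^-1.
Proof.
move=> J0 mf f01; have bf := bmeas_itv mf f01.
pose F (j : 'I_J) : X -> R := \1_[set x | j.+1%:R / J%:R <= f x].
have bF j : bmeas (F j).
  by apply: bmeas_indic; exact: measurable_superlevel.
have bs : bmeas (fun x => \sum_(j < J) F j x) by exact: bmeas_sum.
pose s x := J%:R^-1 * \sum_(j < J) F j x.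
have sE x : s x = layers J (f x).
  by congr (_ * _); apply: eq_bigr => j _; rewrite /F indicE mem_setE.
have bss : bmeas s by exact: bmeasZ.
have bc : bmeas (fun _ : X => J%:R^-1 : R) by exact: bmeas_cst.
have near M : positive_linear M -> M (fun=> 1) = 1 ->
    M s <= M f <= M s + J%:R^-1.
  move=> pM M1; apply/andP; split.
    by apply: (pl_le pM) => // x; rewrite sE; have /andP[] := layers_itv J0 (f01 x).
  have Jc : J%:R^-1 = M (fun=> J%:R^-1) by rewrite (pl_cst pM) M1 mulr1.
  rewrite [X in _ + X]Jc -(pl_add pM)//.
  apply: (pl_le pM) => //; first exact: bmeasD.
  by move=> x; rewrite sE; have /andP[] := layers_itv J0 (f01 x).
have /andP[a1 a2] := near _ plL L1; have /andP[b1 b2] := near _ plL' L'1.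
have sle : `|L s - L' s| <= J%:R^-1 * \sum_(j < J) `|L (F j) - L' (F j)|.
  rewrite /s (pl_scale plL)// (pl_scale plL')// -mulrBr normrM.
  rewrite [`|_^-1|]ger0_norm ?invr_ge0// ler_wpM2l ?invr_ge0//.
  rewrite (pl_sum plL)// (pl_sum plL')// -sumrB.
  exact: ler_norm_sum.
apply: le_trans (lerD sle (lexx _)).
have n1 := ler_norm (L s - L' s); have n2 := ler_norm (L' s - L s).
rewrite (distrC (L' s)) in n2.
by rewrite ler_norml; apply/andP; split; lra.
Qed.

End functional_comparison.

Lemma ae_le_Rintegral d (T : measurableType d) (R : realType)
    (P : probability T R) (f g : T -> R) : bmeas f -> bmeas g ->
  (forall w, 0 <= f w) -> (forall w, 0 <= g w) ->
  {ae P, forall w, f w <= g w} -> \int[P]_w f w <= \int[P]_w g w.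
Proof.
move=> bf bg f0 g0 fg; rewrite -lee_fin !EFin_Rintegral//.
apply: ae_ge0_le_integral => //.
- by move=> w _; rewrite lee_fin.
- by apply/measurable_EFinP; case: bf.
- by move=> w _; rewrite lee_fin.
- by apply/measurable_EFinP; case: bg.
- by apply: filterS fg => w fgw _; rewrite lee_fin.
Qed.

Lemma Rintegral_init_law (R : realType) (zeta : probability (Rm R) R)
    (f : traj R 0 -> R) : bmeas f ->
  \int[init_law zeta]_lam f lam = \int[zeta]_x f (path0 x).
Proof.
have bp (h : traj R 0 -> R) : bmeas h -> bmeas (fun x : Rm R => h (path0 x)).
  by apply: bmeas_comp; exact: measurable_path0.
have pz := positive_linear_Rintegral zeta.
apply: (RintegralE (L := fun f => \int[zeta]_x f (path0 x))).
  split=> [g h bg bh|a g bg|g h bg bh gh].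
  - by rewrite (pl_add pz)//; exact: bp.
  - by rewrite (pl_scale pz)//; exact: bp.
  - by apply: (pl_le pz) => //; exact: bp.
move=> A mA; rewrite /init_law /distribution /pushforward/=.
have mB : measurable ((@path0 R) @^-1` A).
  by rewrite -[X in measurable X]setTI; exact: measurable_path0.
by rewrite -(Rintegral_indic zeta mB).
Qed.

Section particle_analysis.
Context (R : realType) (rho l : R) (y : nat -> R).
Variables (zeta q : probability (Rm R) R).
Hypotheses (rho1 : `|rho| < 1) (l0 : 0 <= l).
Hypotheses (zetal : carried_by l zeta) (ql : carried_by l q).
Hypothesis hy : forall k, (1 <= k)%N -> y k = -1 \/ y k = 1.
Context d (T : measurableType d) (P : probability T R) (N : nat).
Hypothesis N0 : (0 < N)%N.
Variable Z : forall n, 'I_N -> {RV P >-> traj R n}.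

Let Q : nat -> R.-pker (Rm R) ~> (Rm R) := fun=> const_kernel q.
Let filt n w := Pfilter rho y zeta Z n w.

Hypothesis hZ : particle_system rho y zeta Q Z.

Let tau := `|rho|.
Let l' := l / (1 - tau).
Let L := (1 - tau)^-1.

Definition sample_mean n (f : traj R n.+1 -> R) (w : T) : R :=
  N%:R^-1 * \sum_(i < N) f (Z n.+1 i w).

(** The mean of [f] under the law [Qbar R^N_{1:n} zeta] from which the particles of step [n + 1] are
    drawn; it is random through the earlier particles. *)
Definition sampling_law_mean n (f : traj R n.+1 -> R) (w : T) : R :=
  \int[filt n w]_lam predict q f lam.

Lemma positive_linear_sample_mean n w : positive_linear (@sample_mean n ^~ w).
Proof.
rewrite /sample_mean; split=> [f g _ _|a f _|f g _ _ fg].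
- by rewrite -mulrDr -big_split.
- by rewrite -mulr_sumr mulrCA.
- by rewrite ler_wpM2l ?invr_ge0// ler_sum.
Qed.

Lemma positive_linear_sampling_law_mean n w :
  positive_linear (@sampling_law_mean n ^~ w).
Proof. exact: positive_linear_predict. Qed.

Lemma sample_mean1 n w : @sample_mean n (fun=> 1) w = 1.
Proof.
by rewrite /sample_mean sumr_const card_ord mulVf// pnatr_eq0 -lt0n.
Qed.

Lemma sampling_law_mean1 n w : @sampling_law_mean n (fun=> 1) w = 1.
Proof.
rewrite /sampling_law_mean -[RHS](Rintegral_probability_cst (filt n w)).
by apply: eq_Rintegral => lam _; rewrite /predict Rintegral_probability_cst.
Qed.

Lemma measurable_sample n i : measurable_fun setT (Z n i).
Proof. exact: measurable_funPT. Qed.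

(** Stated over an arbitrary measurable space so as to apply both to the full sigma-algebra of [T]
    and to the one generated by the past particles. *)
Lemma measurable_reweight_mean d2 (T2 : measurableType d2) n v
    (z : 'I_N -> T2 -> traj R n) (f : traj R n -> R) :
  (forall i, measurable_fun setT (z i)) -> bmeas f ->
  measurable_fun setT
    (fun w => \int[reweight rho v (empirical R (z ^~ w))]_lam f lam).
Proof.
move=> mz bf.
under eq_fun do rewrite Rintegral_reweight_empirical//.
apply: measurable_fun_div_gt0.
- apply: measurable_sum => i; apply: measurable_funM.
    by apply: measurableT_comp => //; exact: measurable_psi.
  by apply: measurableT_comp => //; case: bf.
- apply: measurable_sum => i.
  by apply: measurableT_comp => //; exact: measurable_psi.
- move=> w; case: N N0 z {mz} => [//|M] _ z.
  by rewrite big_ord_recl ltr_wpDr ?psi_gt0// sumr_ge0// => i _; exact: psi_ge0.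
Qed.

Lemma bmeas_filter_mean n (f : traj R n -> R) : bmeas f ->
  bmeas (fun w => \int[filt n w]_lam f lam).
Proof.
move=> bf; split.
  case: n f bf => [|n] f bf.
    exact: (measurable_cst (\int[init_law zeta]_lam f lam)).
  apply: (@measurable_reweight_mean _ T n.+1 (y n.+1) (fun i => Z n.+1 i) f _ bf) => i.
  exact: measurable_sample.
have [M M0 fM] := bmeas_gt0 bf; exists M => w.
have pl := positive_linear_Rintegral (filt n w).
rewrite (le_trans (le_normr_Rintegral _ (bmeas_integrable _ bf)))//.
rewrite -[leRHS](Rintegral_probability_cst (filt n w)).
by apply: (pl_le pl) => //; [exact: bmeas_norm|exact: bmeas_cst].
Qed.

(** The filter mean at step [n] is measurable for the sigma-algebra of the particles drawn so far,
    so these sets are admissible conditioning events in [particle_system]. *)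
Lemma past_superlevel n (f : traj R n -> R) a : bmeas f ->
  particle_past Z n [set w | a <= \int[filt n w]_lam f lam].
Proof.
move=> bf; pose G : set (set T) := [set B | exists k (i : 'I_N) (A : set (traj R k)),
         [/\ (1 <= k <= n)%N, measurable A & B = Z k i @^-1` A] ].
apply: (@measurable_superlevel _ (g_sigma_algebraType G) R
  (fun w => \int[filt n w]_lam f lam) a).
case: n f bf @G => [|n] f bf G.
  exact: (measurable_cst (\int[init_law zeta]_lam f lam)).
apply: (@measurable_reweight_mean _ (g_sigma_algebraType G) n.+1 (y n.+1)
  (fun i => Z n.+1 i) f _ bf) => i _ A mA; rewrite setTI.
by apply: sub_sigma_algebra; exists n.+1, i, A; split; rewrite ?leqnn.
Qed.

Section one_set.
Variables (n : nat) (A : set (traj R n.+1)).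
Hypothesis mA : measurable A.

Let p := sampling_law_mean (\1_A : traj R n.+1 -> R).
Let H i := Z n.+1 i @^-1` A.
Let bA : bmeas (\1_A : traj R n.+1 -> R). Proof. exact: bmeas_indic. Qed.

Let kactE w : fine (kact (filt n w) (Qbar (Q n.+1) (n := n)) A) = p w.
Proof. exact: fine_kact_Qbar. Qed.

Let kactT w : fine (kact (filt n w) (Qbar (Q n.+1) (n := n)) setT) = 1.
Proof.
rewrite fine_kact_Qbar// -[RHS](sampling_law_mean1 n w).
by congr sampling_law_mean; apply/funext => lam; rewrite indicT.
Qed.

Let mH i : measurable (H i).
Proof. by rewrite -[X in measurable X]setTI; exact: measurable_sample. Qed.

Lemma particle_one i a : P ([set w | a <= p w] `&` H i) =
  (\int[P]_(w in [set w | (a <= p w)%R]) (p w)%:E)%E.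
Proof.
have pB := past_superlevel a (bmeas_predict q bA).
(* Constraining particle [i] alone makes every other factor of the product equal to 1. *)
pose A' j := if j == i then A else setT.
have mA' j : measurable (A' j) by rewrite /A'; case: ifP.
have := hZ pB mA'.
rewrite (_ : \bigcap_j _ = H i); last first.
  apply/seteqP; split => w; first by move=> /(_ i Logic.I); rewrite /A' eqxx.
  by move=> Hw j _; rewrite /A'; case: eqP => [->|].
move=> ->; apply: eq_integral => w _; congr EFin.
rewrite (bigD1 i)//= /A' eqxx kactE big1 ?mulr1// => j /negbTE ->.
exact: kactT.
Qed.

Let particle_two i j : i != j ->
  P (H i `&` H j) = (\int[P]_w (p w ^+ 2)%:E)%E.
Proof.
move=> ij; have pB : particle_past Z n setT.
  (* The whole space is written as a superlevel set to fall under [past_superlevel]. *)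
  rewrite (_ : setT = [set w | 0 <= p w]).
    by apply: past_superlevel; exact: bmeas_predict.
  apply/esym/seteqP; split => // w _ /=.
  apply: (pl_ge0 (positive_linear_sampling_law_mean n w)) => //.
pose A' k := if (k == i) || (k == j) then A else setT.
have mA' k : measurable (A' k) by rewrite /A'; case: ifP.
have := hZ pB mA'.
rewrite (_ : \bigcap_j _ = H i `&` H j); last first.
  apply/seteqP; split => w.
    move=> h; split; first by have := h i Logic.I; rewrite /A' eqxx.
    by have := h j Logic.I; rewrite /A' eqxx orbT.
  by move=> [Hi Hj] k _; rewrite /A'; do 2 case: eqP => [->|]//.
rewrite setTI => ->; apply: eq_integral => w _; congr EFin.
rewrite (bigD1 i)//= (bigD1 j)/=; last by rewrite eq_sym.
rewrite /A' !eqxx orbT kactE mulrA big1 ?mulr1 ?expr2// => k /andP[/negbTE -> /negbTE ->].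
exact: kactT.
Qed.

Lemma mean_sampling_error_indic :
  \int[P]_w `|sample_mean \1_A w - sampling_law_mean \1_A w| <=
  (Num.sqrt N%:R)^-1.
Proof.
have bp : bmeas p by apply: bmeas_filter_mean; exact: bmeas_predict.
have p01 w : 0 <= p w <= 1.
  have pl := positive_linear_sampling_law_mean n w; apply/andP; split.
    by apply: (pl_ge0 pl).
  rewrite -(sampling_law_mean1 n w); apply: (pl_le pl) => //.
  exact: bmeas_cst.
exact: (mean_sampling_error N0 mH bp.1 p01 particle_one particle_two).
Qed.

End one_set.

Lemma bmeas_sample_mean n (f : traj R n.+1 -> R) :
  bmeas f -> bmeas (sample_mean f).
Proof.
move=> bf; apply: bmeasZ; apply: bmeas_sum => i.
by apply: bmeas_comp bf; exact: measurable_sample.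
Qed.

Lemma bmeas_sampling_law_mean n (f : traj R n.+1 -> R) :
  bmeas f -> bmeas (sampling_law_mean f).
Proof. by move=> bf; apply: bmeas_filter_mean; exact: bmeas_predict. Qed.

Let plP := positive_linear_Rintegral P.

(** Each of the [J] layers is a set with error at most [1 / sqrt N] and enters with weight [1 / J],
    so the total obeys the same bound up to a mesh error that tends to 0. *)
Let mean_sampling_error01 n (f : traj R n.+1 -> R) :
  measurable_fun setT f -> (forall lam, 0 <= f lam <= 1) ->
  \int[P]_w `|sample_mean f w - sampling_law_mean f w| <= (Num.sqrt N%:R)^-1.
Proof.
move=> mf f01; have bf := bmeas_itv mf f01.
rewrite -subr_le0; apply: (@le0_of_le_invn _ _ 1) => J J0.
rewrite lerBlDr mul1r addrC.
pose F (j : 'I_J) : traj R n.+1 -> R := \1_[set x | j.+1%:R / J%:R <= f x].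
have mF (j : 'I_J) : measurable [set x | j.+1%:R / J%:R <= f x].
  exact: measurable_superlevel.
have bF j : bmeas (F j) by exact: bmeas_indic.
have bd (h : traj R n.+1 -> R) : bmeas h ->
    bmeas (fun w => `|sample_mean h w - sampling_law_mean h w|).
  move=> bh; apply: bmeas_norm; apply: bmeasB.
    exact: bmeas_sample_mean.
  exact: bmeas_sampling_law_mean.
have bFs : bmeas (fun w => \sum_(j < J)
    `|sample_mean (F j) w - sampling_law_mean (F j) w|).
  by apply: bmeas_sum => j; exact: bd.
have bc : bmeas (fun _ : T => J%:R^-1 : R) by exact: bmeas_cst.
apply: (@le_trans _ _ (\int[P]_w (J%:R^-1 * \sum_(j < J)
    `|sample_mean (F j) w - sampling_law_mean (F j) w| + J%:R^-1))).
  apply: (pl_le plP); [exact: bd|by apply: bmeasD => //; exact: bmeasZ|].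
  move=> w; apply: (functional_diff_layers (positive_linear_sample_mean n w)
    (positive_linear_sampling_law_mean n w)) => //.
    exact: sample_mean1.
  exact: sampling_law_mean1.
rewrite (pl_add plP)//; last exact: bmeasZ.
rewrite Rintegral_probability_cst lerD2r (pl_scale plP)//.
rewrite ler_pdivrMl ?ltr0n// (pl_sum plP); last by move=> j; exact: bd.
have -> : J%:R * (Num.sqrt N%:R)^-1 = \sum_(j < J) (Num.sqrt N%:R)^-1 :> R.
  by rewrite sumr_const card_ord -[RHS]mulr_natl.
by apply: ler_sum => j _; exact: mean_sampling_error_indic.
Qed.

Lemma mean_sampling_error_bounded n (f : traj R n.+1 -> R) M :
  bmeas f -> 0 < M -> (forall lam, `|f lam| <= M) ->
  \int[P]_w `|sample_mean f w - sampling_law_mean f w| <=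
  2 * M / Num.sqrt N%:R.
Proof.
move=> bf M0 fM; pose g lam := (f lam + M) / (2 * M).
have M20 : 0 < 2 * M by rewrite mulr_gt0.
have mg : measurable_fun setT g.
  by apply: measurable_funM => //; apply: measurable_funD => //; case: bf.
have g01 lam : 0 <= g lam <= 1.
  have := fM lam; rewrite ler_norml => /andP[h1 h2].
  by rewrite ler_pdivlMr// ler_pdivrMr//; apply/andP; split; lra.
have bg := bmeas_itv mg g01.
have fE : f = fun lam => 2 * M * g lam + (- M).
  by apply/funext => lam; rewrite /g; field; rewrite gt_eqF.
rewrite -ler_pdivrMl// mulrC; apply: le_trans (mean_sampling_error01 mg g01).
rewrite ler_pdivrMr// mulrC -(pl_scale plP); last first.
  apply: bmeas_norm; apply: bmeasB.
    exact: bmeas_sample_mean.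
  exact: bmeas_sampling_law_mean.
rewrite le_eqVlt; apply/orP; left; apply/eqP/eq_Rintegral => w _.
(* The constant [- M] will cancel in the difference because both functionals have total mass 1. *)
have aff (F : (traj R n.+1 -> R) -> R) : positive_linear F -> F (fun=> 1) = 1 ->
    F f = 2 * M * F g + (- M).
  move=> pF F1; rewrite fE (pl_add pF); [|exact: bmeasZ|exact: bmeas_cst].
  by rewrite (pl_scale pF)// (pl_cst pF) F1 mulr1.
rewrite (aff _ (positive_linear_sample_mean n w) (sample_mean1 n w)).
rewrite (aff _ (positive_linear_sampling_law_mean n w) (sampling_law_mean1 n w)).
rewrite -[X in _ = X * _](gtr0_norm M20) -normrM; congr (`|_|); ring.
Qed.

(** At step 0 the filter is [zeta] itself, hence the guard [0 < k]. *)
Definition samples_confined k w :=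
  (0 < k)%N -> forall i, `|path_X rho (Z k i w)| <= l'.

(** From a confined state, the support of [q] and the invariance of [[- l', l']] keep the next state
    confined, so only the values of [f] on confined paths contribute. *)
Lemma sampling_law_mean_confined k w (f f' : traj R k.+1 -> R) :
  bmeas f -> bmeas f' ->
  samples_confined k w -> (forall lam, `|path_X rho lam| <= l' -> f lam = f' lam) ->
  sampling_law_mean f w = sampling_law_mean f' w.
Proof.
move=> bf bf' cw ff'.
have predE lam : `|path_X rho lam| <= l' -> predict q f lam = predict q f' lam.
  move=> lamX; rewrite /predict.
  rewrite (Rintegral_clamp ql (bmeas_rcons lam bf)).
  rewrite (Rintegral_clamp ql (bmeas_rcons lam bf')).
  apply: eq_Rintegral => x _; apply: ff'; rewrite path_X_rcons.
  by apply: norm_signal_step => //; exact: norm_clamp.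
rewrite /sampling_law_mean /filt; case: k f f' bf bf' cw ff' predE =>
  [|k] f f' bf bf' cw ff' predE /=.
  have bp0 h : bmeas h -> bmeas (fun x : Rm R => predict q h (path0 x)).
    by move=> bh; apply: bmeas_comp (bmeas_predict q bh); exact: measurable_path0.
  rewrite !Rintegral_init_law; try exact: bmeas_predict.
  rewrite (Rintegral_clamp zetal (bp0 _ bf)).
  rewrite (Rintegral_clamp zetal (bp0 _ bf')).
  apply: eq_Rintegral => x _; apply: predE; rewrite path_X0.
  rewrite (le_trans (norm_clamp _ l0))// ler_pdivlMr ?subr_gt0//.
  by rewrite ler_piMr// gerBl normr_ge0.
rewrite !Rintegral_reweight_empirical//; try exact: bmeas_predict.
congr (_ / _); apply: eq_bigr => i _; congr (_ * _); apply: predE.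
exact: cw.
Qed.

(** Induction on the step: if the particles of step [k] are confined, the sampling law of step
    [k + 1] gives mass 0 to unconfined paths, and by [particle_one] almost surely no particle falls
    there. *)
Lemma ae_samples_confined k : {ae P, forall w, samples_confined k w}.
Proof.
elim: k => [|k IH]; first by apply: aeW.
pose A := ~` [set lam : traj R k.+1 | `|path_X rho lam| <= l'].
have mA : measurable A.
  apply: measurableC; apply: measurable_norm_le; exact: measurable_path_X.
have bA : bmeas (\1_A : traj R k.+1 -> R) by exact: bmeas_indic.
have p0 : {ae P, forall w, sampling_law_mean (\1_A : traj R k.+1 -> R) w = 0}.
  apply: filterS IH => w cw.
  rewrite -(pl0 (positive_linear_sampling_law_mean k w)).
  apply: sampling_law_mean_confined => //; first exact: bmeas_cst.
  by move=> lam Xl; rewrite indicE memNset.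
have Z0 i : P (Z k.+1 i @^-1` A) = 0%E.
  have := particle_one mA i 0; rewrite (_ : [set w | _] = setT).
    rewrite setTI => ->; rewrite (ae_eq_integral (cst 0%E)) ?integral0//.
      apply/measurable_EFinP.
      by have [] := bmeas_sampling_law_mean bA.
    by apply: filterS p0 => w -> _.
  apply/seteqP; split => // w _ /=.
  exact: (pl_ge0 (positive_linear_sampling_law_mean k w)).
have : {ae P, forall w, forall i, `|path_X rho (Z k.+1 i w)| <= l'}.
  apply: filter_forall => i.
  exists (Z k.+1 i @^-1` A); split => //.
  by rewrite -[X in measurable X]setTI; exact: measurable_sample.
by apply: filterS => w h _.
Qed.

End particle_analysis.

(** * Telescoping *)

(** Centring both numerators by the same [c] leaves the difference of the quotients unchanged; the
    errors of numerator and denominator then enter with weights 1 and [D], whatever the size of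
    [c]. *)
Lemma ratio_diff_le (R : realType) (a b c s t w D : R) :
  0 < w -> w <= s -> 0 < t -> `|b - c * t| <= D * t ->
  `|a / s - b / t| <= (`|(a - c * s) - (b - c * t)| + D * `|s - t|) / w.
Proof.
move=> w0 ws t0 bt; have s0 : 0 < s by exact: lt_le_trans ws.
have -> : a / s - b / t =
    ((a - c * s) - (b - c * t)) / s + (b - c * t) / t * (t - s) / s.
  by field; rewrite !gt_eqF.
rewrite -mulrDl normrM [`|s^-1|]gtr0_norm ?invr_gt0//.
apply: ler_pM => //; [by rewrite invr_ge0 ltW| |by rewrite lef_pV2].
rewrite (le_trans (ler_normD _ _))// lerD2l normrM (distrC t) ler_wpM2r//.
by rewrite normrM [`|t^-1|]gtr0_norm ?invr_gt0// ler_pdivrMr.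
Qed.

Lemma sum_geometric_le (R : realType) (x : R) n :
  0 <= x < 1 -> \sum_(i < n) x ^+ i <= (1 - x)^-1.
Proof.
move=> /andP[x0 x1]; have x10 : 0 < 1 - x by rewrite subr_gt0.
rewrite -[leRHS]mul1r ler_pdivlMr// mulrC.
have -> : (1 - x) * \sum_(i < n) x ^+ i = 1 - x ^+ n.
  by rewrite -opprB mulNr -subrX1 opprB.
by rewrite gerBl exprn_ge0.
Qed.

Section uniform_bound.
Context (R : realType) (rho l : R) (y : nat -> R).
Variables (zeta q : probability (Rm R) R).
Hypotheses (rho1 : `|rho| < 1) (l0 : 0 <= l).
Hypotheses (zetal : carried_by l zeta) (ql : carried_by l q).
Hypothesis hy : forall k, (1 <= k)%N -> y k = -1 \/ y k = 1.
Context d (T : measurableType d) (P : probability T R) (N : nat).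
Hypothesis N0 : (0 < N)%N.
Variable Z : forall n, 'I_N -> {RV P >-> traj R n}.

Let Q : nat -> R.-pker (Rm R) ~> (Rm R) := fun=> const_kernel q.
Let filt n w := Pfilter rho y zeta Z n w.

Hypothesis hZ : particle_system rho y zeta Q Z.

Let tau := `|rho|.
Let l' := l / (1 - tau).
Let L := (1 - tau)^-1.

Variables (g : R -> R) (D B : R).
Hypotheses (bg : bmeas g) (D0 : 0 < D) (B0 : 0 < B).
Hypothesis LB : (2 * L + B) * tau <= (1 + tau) / 2 * B.
Hypothesis gB : forall u u', `|u| <= l' -> `|u'| <= l' ->
  `|g u - g u'| <= D * (1 - expR (- (B * `|u - u'|))).

Let kappa := 1 - expR (- (2 * l' * B)) * ((1 - tau) / 2).

Let one : R -> R := fun=> 1.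
Let bone : bmeas one. Proof. exact: bmeas_cst. Qed.
Let bwd := backward q rho y.

Let l'0 : 0 <= l'. Proof. by rewrite divr_ge0// subr_ge0 ltW. Qed.
Let L0 : 0 <= L. Proof. by rewrite invr_ge0 subr_ge0 ltW. Qed.

Let bpath k (h : R -> R) : bmeas h -> bmeas (fun lam : traj R k => h (path_X rho lam)).
Proof. by apply: bmeas_comp; exact: measurable_path_X. Qed.

Lemma predict_backward j k h (lam : traj R k) :
  predict q (fun lam' => psi rho (y k.+1) lam' * bwd j k.+1 h (path_X rho lam')) lam =
  bwd j.+1 k h (path_X rho lam).
Proof.
exact: (predict_path_X q rho (fun v => psiX (y k.+1) v * bwd j k.+1 h v)).
Qed.

(** A filtering step absorbs one backward step up to a normalising factor that cancels in the
    quotient, so the value depends on [k + j] only. *)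
Lemma Rfilter_backward k j :
  (\int[Rfilter rho y zeta Q k]_lam bwd j k g (path_X rho lam)) /
  (\int[Rfilter rho y zeta Q k]_lam bwd j k one (path_X rho lam)) =
  (\int[init_law zeta]_lam bwd (k + j) 0 g (path_X rho lam)) /
  (\int[init_law zeta]_lam bwd (k + j) 0 one (path_X rho lam)).
Proof.
elim: k j => [//|k IH] j; rewrite addSnnS -IH [Rfilter _ _ _ _ k.+1]/=.
set mu := Rfilter rho y zeta Q k.
have step h : bmeas h ->
    \int[Rstep rho y Q mu]_lam bwd j k.+1 h (path_X rho lam) =
    (\int[mu]_lam bwd j.+1 k h (path_X rho lam)) /
    \int[mu]_lam predict q (@psi R rho (y k.+1) k.+1) lam.
  move=> bh; rewrite Rintegral_Rstep; last exact/bpath/bmeas_backward.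
  by congr (_ / _); apply: eq_Rintegral => lam _; exact: predict_backward.
rewrite !step// -mulf_div divff ?mulr1//.
rewrite invr_neq0// gt_eqF//.
have bpsi := @bmeas_psi R rho (y k.+1) k.+1.
apply: Rintegral_gt0 => [|lam]; first exact: bmeas_predict.
by apply: predict_gt0 => // lam'; exact: psi_gt0.
Qed.

(** Filtering by particles up to time [k] and exactly for the remaining [j] steps: [ratio n 0] is
    the particle filter's mean of [g], [ratio 0 n] the exact one. *)
Let ratio k j w :=
  (\int[filt k w]_lam bwd j k g (path_X rho lam)) /
  (\int[filt k w]_lam bwd j k one (path_X rho lam)).

Section one_step.
Variables k j : nat.

(** [W] is the potential and [V] the numerator centred at [m 0], of size at most [Delta * W] on
    [[- l', l']]; [Wlow] and [Whigh] bound [W] there. *)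
Let W v := psiX (y k.+1) v * bwd j k.+1 one v.
Let m := backward_mean q rho y g j k.+1.
Let V v := W v * (m v - m 0).
Let Wlow := expR (- (L * l')) * W 0.
Let Whigh := expR (L * l') * W 0.
Let Delta := kappa ^+ j * D.
Let conf (h : R -> R) (lam : traj R k.+1) := h (clamp l' (path_X rho lam)).

Let bW : bmeas W.
Proof. by apply: bmeasM; [exact: bmeas_psiX|exact: bmeas_backward]. Qed.

Let bm : bmeas m. Proof. exact: bmeas_backward_mean. Qed.

Let bV : bmeas V.
Proof. by apply: bmeasM => //; apply: bmeasB => //; exact: bmeas_cst. Qed.

Let W0 v : 0 < W v.
Proof. by rewrite mulr_gt0 ?psiX_gt0 ?backward_gt0. Qed.

Let Delta0 : 0 < Delta.
Proof.
have /andP[k0 _] := kappa_itv rho1 l0 B0.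
by rewrite mulr_gt0// exprn_gt0.
Qed.

Let W_bounds v : `|v| <= l' -> Wlow <= W v <= Whigh.
Proof.
move=> vl; have Lw := backward_potential_log_lipschitz q rho1 hy j k.
apply/andP; split.
  apply: le_trans (Lw 0 v); rewrite sub0r normrN ler_wpM2r ?(ltW (W0 _))//.
  by rewrite ler_expR lerN2 ler_wpM2l.
rewrite /Whigh -ler_pdivrMl ?expR_gt0// -expRN.
apply: le_trans (Lw v 0); rewrite subr0 ler_wpM2r ?(ltW (W0 _))//.
by rewrite ler_expR lerN2 ler_wpM2l.
Qed.

Let m_osc v : `|v| <= l' -> `|m v - m 0| <= Delta.
Proof.
move=> vl; have n0 : `|0 : R| <= l' by rewrite normr0.
apply: le_trans (backward_mean_contraction rho1 l0 ql hy bg (ltW D0) B0 LB gB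
  j k.+1 vl n0) _.
by rewrite ler_piMr ?(ltW Delta0)// gerBl expR_ge0.
Qed.

Let bconf h : bmeas h -> bmeas (conf h).
Proof.
move=> bh; rewrite /conf.
apply: (bmeas_comp (phi := fun lam : traj R k.+1 => clamp l' (path_X rho lam))) bh.
by apply: measurableT_comp; [exact: measurable_clamp|exact: measurable_path_X].
Qed.

Let conf_id h lam : `|path_X rho lam| <= l' -> conf h lam = h (path_X rho lam).
Proof. by move=> Xl; rewrite /conf clamp_id. Qed.

(** The bound of [ratio_diff_le] with [Wlow] for [w] and [Delta] for [D]. *)
Definition step_error (w : T) : R :=
  (`|sample_mean Z (conf V) w - sampling_law_mean rho y zeta q Z (conf V) w| +
   Delta * `|sample_mean Z (conf W) w -
             sampling_law_mean rho y zeta q Z (conf W) w|) / Wlow.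

Let Wlow0 : 0 < Wlow. Proof. by rewrite mulr_gt0 ?expR_gt0. Qed.
Let Whigh0 : 0 < Whigh. Proof. by rewrite mulr_gt0 ?expR_gt0. Qed.

Let confX (lam : traj R k.+1) : `|clamp l' (path_X rho lam)| <= l'.
Proof. exact: norm_clamp. Qed.

Let W_conf (lam : traj R k.+1) : `|conf W lam| <= Whigh.
Proof.
have c0 : 0 < conf W lam by exact: W0.
by rewrite gtr0_norm//; have /andP[] := W_bounds (confX lam).
Qed.

Let V_conf (lam : traj R k.+1) : `|conf V lam| <= Whigh * Delta.
Proof.
rewrite normrM; apply: ler_pM => //; first exact: W_conf.
exact: m_osc.
Qed.

Let bdiff (f : traj R k.+1 -> R) : bmeas f ->
  bmeas (fun w => `|sample_mean Z f w - sampling_law_mean rho y zeta q Z f w|).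
Proof.
move=> bf; apply: bmeas_norm; apply: bmeasB; first exact: bmeas_sample_mean.
exact: bmeas_sampling_law_mean.
Qed.

Lemma bmeas_step_error : bmeas step_error.
Proof.
rewrite /step_error; apply: bmeasM; last exact: bmeas_cst.
by apply: bmeasD; [|apply: bmeasZ]; apply: bdiff; exact: bconf.
Qed.

Lemma step_error_ge0 w : 0 <= step_error w.
Proof.
by rewrite divr_ge0 ?(ltW Wlow0)// addr_ge0// mulr_ge0// ltW.
Qed.

(** Inside the parentheses each of the two terms contributes [2 Whigh Delta / sqrt N], and
    [Whigh / Wlow = exp (2 L l')]. *)
Lemma mean_step_error :
  \int[P]_w step_error w <= kappa ^+ j * (4 * D * expR (2 * L * l') / Num.sqrt N%:R).
Proof.
have plP := positive_linear_Rintegral P.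
have bcV := bdiff (bconf bV); have bcW := bdiff (bconf bW).
rewrite (_ : step_error = fun w => Wlow^-1 *
  (`|sample_mean Z (conf V) w - sampling_law_mean rho y zeta q Z (conf V) w| +
   Delta * `|sample_mean Z (conf W) w -
             sampling_law_mean rho y zeta q Z (conf W) w|)); last first.
  by apply/funext => w; rewrite mulrC.
rewrite (pl_scale plP); last by apply: bmeasD => //; exact: bmeasZ.
rewrite (pl_add plP)//; last exact: bmeasZ.
rewrite (pl_scale plP)//.
have WD0 : 0 < Whigh * Delta by rewrite mulr_gt0.
have eV := mean_sampling_error_bounded N0 hZ (bconf bV) WD0 V_conf.
have eW := mean_sampling_error_bounded N0 hZ (bconf bW) Whigh0 W_conf.
have sN0 : 0 < Num.sqrt N%:R :> R by rewrite sqrtr_gt0 ltr0n.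
apply: (@le_trans _ _ (Wlow^-1 * (2 * (Whigh * Delta) / Num.sqrt N%:R +
    Delta * (2 * Whigh / Num.sqrt N%:R)))).
  rewrite ler_wpM2l ?invr_ge0 ?(ltW Wlow0)// lerD//.
  by rewrite ler_wpM2l// ltW.
have -> : expR (2 * L * l') = expR (L * l') / expR (- (L * l')).
  by rewrite expRN invrK -expRD; congr expR; ring.
rewrite le_eqVlt; apply/orP; left; apply/eqP.
rewrite /Wlow /Whigh /Delta; field.
by rewrite !gt_eqF ?expR_gt0.
Qed.

(* Replacing the test functions by their clamped versions makes them bounded
   and changes nothing on confined samples. *)
Lemma ratio_step w : samples_confined rho l Z k w -> samples_confined rho l Z k.+1 w ->
  `|ratio k.+1 j w - ratio k j.+1 w| <= step_error w.
Proof.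
move=> ck ck1.
pose U h v := psiX (y k.+1) v * bwd j k.+1 h v.
have bU h : bmeas h -> bmeas (U h).
  by move=> bh; apply: bmeasM; [exact: bmeas_psiX|exact: bmeas_backward].
have Um v : U g v = W v * m v.
  rewrite /U /W /m /backward_mean -mulrA; congr (_ * _).
  by rewrite mulrC divfK// gt_eqF// backward_gt0.
have lawE h : bmeas h -> \int[filt k w]_lam bwd j.+1 k h (path_X rho lam) =
    sampling_law_mean rho y zeta q Z (conf (U h)) w.
  move=> bh; rewrite -(sampling_law_mean_confined y rho1 l0 zetal ql N0
    (f := fun lam : traj R k.+1 => U h (path_X rho lam)) _ _ ck).
  - by apply: eq_Rintegral => lam _; rewrite -predict_backward.
  - by apply: bpath; exact: bU.
  - by apply: bconf; exact: bU.
  - by move=> lam Xl; rewrite conf_id.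
have sampleE h : sample_mean Z (conf (U h)) w =
    sample_mean Z (fun lam : traj R k.+1 => U h (path_X rho lam)) w.
  congr (_ * _); apply: eq_bigr => i _; rewrite conf_id//.
  exact: ck1.
have pS := positive_linear_sample_mean Z k w.
have pM := positive_linear_sampling_law_mean rho y zeta q Z k w.
have N0R : 0 < N%:R :> R by rewrite ltr0n.
(* Both reweighted means carry the same normalising sum of [psi], which cancels. *)
have rS : ratio k.+1 j w =
    sample_mean Z (conf (U g)) w / sample_mean Z (conf (U one)) w.
  rewrite !sampleE /ratio /filt /= !Rintegral_reweight_empirical//;
    try by apply: bpath; exact: bmeas_backward.
  rewrite -mulf_div divff ?mulr1.
    by rewrite -[RHS]mulf_div divff ?mul1r// invr_neq0// gt_eqF.
  rewrite invr_neq0// gt_eqF//.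
  case: (N) N0 (Z) => [//|M] _ Z'.
  by rewrite big_ord_recl ltr_wpDr ?psi_gt0// sumr_ge0// => i _; exact: psi_ge0.
rewrite rS /ratio !lawE//.
have -> : U one = W by [].
(* Splits off [m 0] times the denominator, so that [c = m 0] in [ratio_diff_le] leaves the centred
   [V]. *)
have -> : conf (U g) = fun lam => conf V lam + m 0 * conf W lam.
  by apply/funext => lam; rewrite /conf Um /V; ring.
rewrite (pl_add pS) ?(pl_scale pS) ?(pl_add pM) ?(pl_scale pM);
  try by [exact: bconf|apply: bmeasZ; exact: bconf].
apply: le_trans (ratio_diff_le (c := m 0) (w := Wlow) (D := Delta) _ _ _ _ _) _.
- exact: Wlow0.
- rewrite -[leLHS]mulr1 -(sample_mean1 N0 Z k w) -(pl_scale pS); last exact: bmeas_cst.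
  apply: (pl_le pS); [by apply: bmeasZ; exact: bmeas_cst|exact: bconf|].
  by move=> lam; rewrite mulr1; have /andP[] := W_bounds (confX lam).
- apply: (@lt_le_trans _ _ Wlow) => //.
  rewrite -[leLHS]mulr1 -(sampling_law_mean1 rho y zeta q Z k w).
  rewrite -(pl_scale pM); last exact: bmeas_cst.
  apply: (pl_le pM); [by apply: bmeasZ; exact: bmeas_cst|exact: bconf|].
  by move=> lam; rewrite mulr1; have /andP[] := W_bounds (confX lam).
- rewrite addrK -(pl_scale pM); last exact: bconf.
  have bcV := bconf bV; have bcW := bconf bW.
  have VW lam : `|conf V lam| <= Delta * conf W lam.
    by rewrite normrM (gtr0_norm (W0 _)) mulrC ler_wpM2r ?(ltW (W0 _))//; exact: m_osc.
  have bDW : bmeas (fun lam => Delta * conf W lam) by exact: bmeasZ.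
  rewrite ler_norml; apply/andP; split.
    rewrite -mulN1r -(pl_scale pM)//; apply: (pl_le pM) => //; first exact: bmeasZ.
    by move=> lam; have := VW lam; rewrite ler_norml mulN1r => /andP[].
  apply: (pl_le pM) => // lam.
  by have := VW lam; rewrite ler_norml => /andP[].
by rewrite !addrK.
Qed.

End one_step.

(** Exact steps are exchanged for particle steps one at a time; the error of step [k + 1] is damped
    by [kappa ^+ (n - k.+1)], and the geometric series bounds the sum uniformly in [n]. *)
Lemma mean_filter_diff n :
  \int[P]_w `|filter_diff rho y zeta Q Z (fun lam : traj R n => g (path_X rho lam)) w|
  <= 4 * D * expR (2 * L * l') / (1 - kappa) / Num.sqrt N%:R.
Proof.
have plP := positive_linear_Rintegral P.
have b1 := bpath n bg.
have bfd : bmeas (fun w => `|filter_diff rho y zeta Q Z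
    (fun lam : traj R n => g (path_X rho lam)) w|).
  apply: bmeas_norm; apply: bmeasB; first exact: bmeas_cst.
  exact: bmeas_filter_mean.
have bes : bmeas (fun w => \sum_(k < n) step_error k (n - k.+1) w).
  by apply: bmeas_sum => k; exact: bmeas_step_error.
have es0 w : 0 <= \sum_(k < n) step_error k (n - k.+1) w.
  by apply: sumr_ge0 => k _; exact: step_error_ge0.
apply: le_trans (ae_le_Rintegral bfd bes _ es0 _) _ => //.
  (* Countably many almost sure events: confinement holds at all steps at once. *)
  have := ae_foralln (ae_samples_confined rho1 l0 zetal ql N0 hZ).
  apply: filterS => w cw.
  have r0 : \int[Rfilter rho y zeta Q n]_lam g (path_X rho lam) = ratio 0 n w.
    have := Rfilter_backward n 0; rewrite addn0 /ratio => <-.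
    by rewrite /= /one Rintegral_probability_cst divr1.
  have rn : \int[filt n w]_lam g (path_X rho lam) = ratio n 0 w.
    by rewrite /ratio /= /one Rintegral_probability_cst divr1.
  rewrite /filter_diff r0 rn distrC.
  have -> : ratio n 0 w - ratio 0 n w =
      \sum_(k < n) (ratio k.+1 (n - k.+1) w - ratio k (n - k) w).
    rewrite -(big_mkord xpredT (fun k => ratio k.+1 (n - k.+1) w - ratio k (n - k) w)).
    by rewrite (telescope_sumr (fun k => ratio k (n - k) w))// subnn subn0.
  apply: le_trans (ler_norm_sum _ _ _) _; apply: ler_sum => k _.
  (* As [k < n], [n - k] is the successor of [n - k.+1], the form required by [ratio_step]. *)
  by rewrite -(subnSK (ltn_ord k)); apply: ratio_step; exact: cw.
rewrite (pl_sum plP); last by move=> k; exact: bmeas_step_error.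
have kappa01 : 0 <= kappa < 1.
  by have /andP[k0 ->] := kappa_itv rho1 l0 B0; rewrite ltW.
apply: (@le_trans _ _ (\sum_(k < n) kappa ^+ (n - k.+1) *
    (4 * D * expR (2 * L * l') / Num.sqrt N%:R))).
  by apply: ler_sum => k _; exact: mean_step_error.
rewrite -mulr_suml (reindex_inj rev_ord_inj)/=.
under eq_bigr => k _ do rewrite subnSK ?ltn_ord// subKn ?(ltnW (ltn_ord k))//.
rewrite [leRHS]mulrAC mulrC [leRHS]mulrAC -[leRHS]mulrAC ler_wpM2l//.
  by rewrite !mulr_ge0 ?expR_ge0 ?invr_ge0 ?sqrtr_ge0 ?(ltW D0).
exact: sum_geometric_le.
Qed.

End uniform_bound.

(** * Lipschitz test functions and choice of constants *)

Lemma lipschitz_le (R : realType) (K : R) (g : R -> R) : K.-lipschitz g ->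
  forall u u', `|g u - g u'| <= K * `|u - u'|.
Proof. by move=> gK u u'; apply: (gK (u, u')). Qed.

Lemma lipschitz_measurable (R : realType) (K : R) (g : R -> R) :
  0 < K -> K.-lipschitz g -> measurable_fun setT g.
Proof.
move=> K0 gK; apply: continuous_measurable_fun => u.
apply/cvgrPdist_le => e e0; near=> v.
rewrite (le_trans (lipschitz_le gK u v))// mulrC -ler_pdivlMr//.
near: v; apply/nbhs_ballP; exists (e / K) => /=; first by rewrite divr_gt0.
by move=> v; rewrite /ball/= => /ltW.
Unshelve. all: by end_near. Qed.

(** With [x = B r], [x <= exp x - 1 = exp x (1 - exp (- x))] and [exp x <= exp (S B)]. This brings
    Lipschitz functions on a bounded set under the exponential modulus. *)
Lemma lin_le_exp_modulus (R : realType) (K B r S : R) :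
  0 < K -> 0 < B -> 0 <= r <= S ->
  K * r <= K * expR (S * B) / B * (1 - expR (- (B * r))).
Proof.
move=> K0 B0 /andP[r0 rS].
have e0 : 0 < expR (B * r) by exact: expR_gt0.
have h1 : B * r <= expR (B * r) * (1 - expR (- (B * r))).
  rewrite mulrBr mulr1 -expRD subrr expR0.
  by have := expR_ge1Dx (B * r); lra.
have h2 : expR (B * r) <= expR (S * B).
  by rewrite ler_expR mulrC ler_wpM2r// ltW.
have h3 : 0 <= 1 - expR (- (B * r)).
  by rewrite subr_ge0 -expR0 ler_expR oppr_le0 mulr_ge0// ltW.
have -> : K * r = K / B * (B * r) by field; rewrite gt_eqF.
have -> : K * expR (S * B) / B = K / B * expR (S * B) by rewrite mulrAC.
rewrite -[leRHS]mulrA ler_wpM2l ?divr_ge0 ?(ltW K0) ?(ltW B0)//.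
by apply: le_trans h1 _; rewrite ler_wpM2r.
Qed.

Lemma ler_ln_exists (R : realType) (a : R) :
  exists N0, forall N, (N0 <= N)%N -> (0 < N)%N /\ a <= ln (N%:R : R).
Proof.
exists (Num.truncn (expR a)).+1 => N hN.
have N0 : (0 < N)%N by exact: leq_trans hN.
split=> //; rewrite -[leLHS]expRK ler_ln ?posrE ?expR_gt0 ?ltr0n//.
apply: (@le_trans _ _ (Num.truncn (expR a)).+1%:R); last by rewrite ler_nat.
by rewrite ltW//; have /andP[] := truncn_itv (expR_ge0 a).
Qed.

Lemma hidden_markov_model_carried (R : realType) (rho l : R)
    d (T : measurableType d) (P : probability T R)
    (Lambda Y : nat -> {RV P >-> R}) (zeta q : probability (Rm R) R) :
  hidden_markov_model rho l Lambda Y zeta q -> carried_by l zeta /\ carried_by l q.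
Proof.
move=> model; have mA : measurable (~` [set x : Rm R | `|x| <= l]).
  by apply: measurableC; exact: (@measurable_norm_le _ (Rm R) R l id).
have empty n : Lambda n @^-1` (~` [set x : Rm R | `|x| <= l]) = set0.
  apply/seteqP; split => // w /=; apply.
  by rewrite ler_norml (hmm_support model).
split; rewrite /carried_by.
  by rewrite -(hmm_law0 model mA) empty measure0.
by rewrite -(hmm_law model (leqnn 1) mA) empty measure0.
Qed.

Theorem lemma15 (R : realType) (rho l K : R)
    (hrho : -1 < rho < 1) (hrho0 : rho != 0) (hl : 0 < l) (hK : 0 < K)
    (d : measure_display) (T : measurableType d) (P : probability T R)
    (Lambda Y : nat -> {RV P >-> R})
    (zeta q : probability (measurableTypeR R) R)
    (model : hidden_markov_model rho l Lambda Y zeta q)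
    (y : nat -> R) (hy : forall n, (1 <= n)%N -> y n = -1 \/ y n = 1) :
  let tau := `|rho| in
  let l' := l / (1 - tau) in
  let c := expR l' in
  let phi := expR (2 * l') - 1 in
  let eps : R := 1 in
  let C := 16 / (eps ^+ 6 * c ^+ 2) * (- 1 / ln tau)
           * (4 * c / (3 * phi)) `^ (3 * ln c / ln tau) in
  let D := 2 * ln (3 * phi / (4 * c * tau)) in
  let E0 := 4 * K * l' * c / (3 * phi) in
  tau * c ^+ 3 < 1 ->
  exists N0 : nat, forall N : nat, (N0 <= N)%N -> forall n : nat, (1 <= n)%N ->
    forall (d' : measure_display) (T' : measurableType d')
      (P' : probability T' R)
      (Z : forall k : nat, 'I_N -> {RV P' >-> (k.+1).-tuple (measurableTypeR R)}),
    particle_system rho y zeta (fun=> const_kernel q) Z ->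
    (particle_error rho y zeta (fun=> const_kernel q) Z K n <=
      (C * (ln N%:R + D) * (1 / Num.sqrt N%:R) `^ (1 + 3 * ln c / ln tau)
       + E0 / Num.sqrt N%:R)%:E)%E.
Proof.
move=> tau l' c phi eps C D E0 _.
have tau1 : tau < 1 by rewrite ltr_norml.
have tau0 : 0 < tau by rewrite normr_gt0.
have tau1' : 0 < 1 - tau by rewrite subr_gt0.
have l'0 : 0 < l' by rewrite divr_gt0.
have lntau : ln tau < 0 by apply: ln_lt0; rewrite tau0.
have phi0 : 0 < phi by rewrite subr_gt0 -expR0 ltr_expR mulr_gt0.
have c0 : 0 < c by exact: expR_gt0.
have C0 : 0 < C.
  apply: mulr_gt0; last by apply: powR_gt0; rewrite divr_gt0 ?mulr_gt0.
  apply: mulr_gt0; first by rewrite divr_gt0 ?mulr_gt0 ?exprn_gt0 /eps.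
  by rewrite -mulrNN -invrN mulr_gt0 ?opprK ?invr_gt0 ?oppr_gt0.
have E00 : 0 <= E0 by apply/ltW/divr_gt0; rewrite !mulr_gt0 ?invr_gt0.
(* Here [ln c = l'] is positive and [ln tau] is negative. *)
have alpha1 : 1 + 3 * ln c / ln tau <= 1.
  rewrite gerDl /c expRK ler_ndivrMr// mul0r.
  by rewrite mulr_ge0// ltW.
have [zetal ql] := hidden_markov_model_carried model.
pose L := (1 - tau)^-1.
(* The value of [B] for which [LB] is an equality. *)
pose B := 4 * L * tau / (1 - tau).
have L0 : 0 < L by rewrite invr_gt0.
have B0 : 0 < B by rewrite divr_gt0 ?mulr_gt0.
have LB : (2 * L + B) * tau <= (1 + tau) / 2 * B.
  rewrite le_eqVlt; apply/orP; left; apply/eqP.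
  by rewrite /B; field; rewrite gt_eqF.
(* Constant of [lin_le_exp_modulus] for [S = 2 l'], the diameter of [[- l', l']]. *)
pose Dg := K * expR (2 * l' * B) / B.
have Dg0 : 0 < Dg by rewrite divr_gt0 ?mulr_gt0 ?expR_gt0.
pose kappa := 1 - expR (- (2 * l' * B)) * ((1 - tau) / 2).
pose C' := 4 * Dg * expR (2 * L * l') / (1 - kappa).
(* From this threshold on, [C' <= C (ln N + D)]; neither [n] nor the particles enter these
   constants. *)
have [N0 hN0] := ler_ln_exists (C' / C - D).
exists N0; move=> N /hN0[N_gt0 lnN] n _ d' T' P' Z hZ.
apply: ub_ereal_sup => _ [g [gsup gK] <-].
have mg := lipschitz_measurable hK gK.
have g1 v : `|g v| <= 1.
  by rewrite -lee_fin -gsup; apply: ereal_sup_ubound; exists v.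
have bg : bmeas g by split=> //; exists 1.
have gB u u' : `|u| <= l' -> `|u'| <= l' ->
    `|g u - g u'| <= Dg * (1 - expR (- (B * `|u - u'|))).
  move=> ul u'l; apply: le_trans (lipschitz_le gK u u') _.
  apply: lin_le_exp_modulus => //; rewrite normr_ge0/=.
  by rewrite (le_trans (ler_normB _ _))// mulrDl mul1r lerD.
have main := mean_filter_diff tau1 (ltW hl) zetal ql hy N_gt0 hZ bg Dg0 B0 LB gB n.
rewrite -EFin_Rintegral; last first.
  apply: bmeas_norm; apply: bmeasB; first exact: bmeas_cst.
  apply: bmeas_filter_mean => //; apply: bmeas_comp bg.
  exact: measurable_path_X.
rewrite lee_fin (le_trans main)//.
set s := 1 / Num.sqrt N%:R.
have s0 : 0 < s by rewrite divr_gt0// sqrtr_gt0 ltr0n.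
have s1 : s <= 1.
  rewrite ler_pdivrMr ?sqrtr_gt0 ?ltr0n// mul1r -{1}(sqrtr1 R) ler_sqrt ?ltr0n//.
  by rewrite ler1n.
(* [E0 / sqrt N] is nonnegative, so it remains to compare [C' s] with the first term. *)
rewrite -[leLHS]addr0; apply: lerD; last first.
  by rewrite divr_ge0// sqrtr_ge0.
rewrite -/C' -[X in X <= _](_ : C' * s = _); last by rewrite /s mul1r.
have C'0 : 0 <= C'.
  have /andP[_ k1] := kappa_itv tau1 (ltW hl) B0.
  apply: divr_ge0; last by rewrite subr_ge0 ltW.
  by apply: mulr_ge0; [apply: mulr_ge0 => //; exact: ltW|exact: expR_ge0].
apply: ler_pM => //; first exact: ltW.
  by rewrite -ler_pdivrMl// mulrC -lerBlDr.
(* As [0 < s <= 1], raising [s] to an exponent at most 1 does not decrease it. *)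
by apply: ger1_powR => //; rewrite s0.
Qed.
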